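(* Let $G$ be an uncluttered graph. Then at least one of the following holds: (1) one of $G,\overline{G}$ is disconnected; or (2) one of $G,\overline{G}$ has adjacent simplicial twins (that is, two adjacent vertices that are twins and are both simplicial in that graph); or (3) one of $G,\overline{G}$ is candled; or (4) one of $G,\overline{G}$ is the line graph of a triangle-free graph.
   Context: All graphs are finite, without loops or parallel edges; $\overline{G}$ is the complement of $G$, and $G[X]$ is the subgraph of $G$ induced on $X\subseteq V(G)$. The fork is the five-vertex tree obtained from a four-vertex path by adding a vertex adjacent only to the second vertex of the path. The antifork is the complement of the fork; equivalently, it is obtained from a four-vertex path by adding one more vertex adjacent to exactly the first three vertices of the path. $G$ is uncluttered if no induced subgraph of $G$ is (isomorphic to) a fork or an antifork. For disjoint $X,Y\subseteq V(G)$, $X$ is complete to $Y$ if every vertex of $X$ is adjacent to every vertex of $Y$, and anticomplete to $Y$ if there are no edges between $X$ and $Y$. A clique is a set of pairwise adjacent vertices; a stable set is a set of pairwise nonadjacent vertices. Two distinct vertices $u,v$ of $G$ are twins if they have the same neighbours in $V(G)\setminus\{u,v\}$ ($u,v$ may or may not be adjacent). A vertex is simplicial if the set of its neighbours is a clique. A graph $H$ is a candelabrum with base $Z_1\cup\cdots\cup Z_k$ if $k\ge 1$ is an integer and $Y_1,\ldots,Y_k,Z_1,\ldots,Z_k$ are pairwise disjoint nonempty subsets of $V(H)$ with union $V(H)$ such that: each $Y_i$ is a clique and each $Z_i$ is a stable set; for $1\le i<j\le k$, $Y_i$ is anticomplete to $Y_j$ and $Z_i$ is complete to $Z_j$; and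 for $1\le i,j\le k$, $Y_i$ is complete to $Z_j$ if $i=j$, and anticomplete to $Z_j$ otherwise. A graph $G$ is candled if $G$ has an induced subgraph $H$ that is a candelabrum, with base $Z$ say, such that $Z$ is complete to $V(G)\setminus V(H)$ and $V(H)\setminus Z$ is anticomplete to $V(G)\setminus V(H)$ (the set $V(G)\setminus V(H)$ may be empty). *)

(* Defs.v *)
From mathcomp Require Import all_boot.

Set Implicit Arguments.
Unset Strict Implicit.
Unset Printing Implicit Defensive.

Record sgraph := SGraph {
  vertex :> finType;
  adj : rel vertex;
  adj_sym : symmetric adj;
  adj_irr : irreflexive adj }.

Definition isomorphic (G H : sgraph) : Prop :=
  exists2 f : G -> H, bijective f & forall x y, adj (f x) (f y) = adj x y.

Section Constructions.
Variable G : sgraph.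

Definition compl_adj : rel G := fun x y => (x != y) && ~~ adj x y.

Lemma compl_adj_sym : symmetric compl_adj.
Proof. by move=> x y; rewrite /compl_adj eq_sym adj_sym. Qed.

Lemma compl_adj_irr : irreflexive compl_adj.
Proof. by move=> x; rewrite /compl_adj eqxx. Qed.

Definition compl : sgraph := SGraph compl_adj_sym compl_adj_irr.

Variable S : {set G}.

Definition induced_adj : rel {x : G | x \in S} := fun x y => adj (val x) (val y).

Lemma induced_adj_sym : symmetric induced_adj.
Proof. by move=> x y; apply: adj_sym. Qed.

Lemma induced_adj_irr : irreflexive induced_adj.
Proof. by move=> x; apply: adj_irr. Qed.

Definition induced : sgraph := SGraph induced_adj_sym induced_adj_irr.

End Constructions.

Definition edges (G : sgraph) : {set {set G}} :=
  [set e : {set G} | [exists x : G, exists y : G, adj x y && (e == [set x; y])]].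

Section LineGraph.
Variable G : sgraph.

Definition line_adj : rel {e : {set G} | e \in edges G} :=
  fun e f => (e != f) && (val e :&: val f != set0).

Lemma line_adj_sym : symmetric line_adj.
Proof. by move=> e f; rewrite /line_adj eq_sym setIC. Qed.

Lemma line_adj_irr : irreflexive line_adj.
Proof. by move=> e; rewrite /line_adj eqxx. Qed.

Definition line_graph : sgraph := SGraph line_adj_sym line_adj_irr.

End LineGraph.

Definition triangle_free (G : sgraph) : Prop :=
  forall x y z : G, ~~ [&& adj x y, adj y z & adj x z].

(* The path 0-1-2-3, with 4 adjacent only to 1. *)
Definition fork_edges : seq (nat * nat) := [:: (0, 1); (1, 2); (2, 3); (1, 4)].

Definition fork_adj : rel 'I_5 :=
  fun i j => ((val i, val j) \in fork_edges) || ((val j, val i) \in fork_edges).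

Lemma fork_adj_sym : symmetric fork_adj.
Proof. by move=> i j; rewrite /fork_adj orbC. Qed.

Lemma fork_adj_irr : irreflexive fork_adj.
Proof. by case=> [[|[|[|[|[|i]]]]] lti]. Qed.

Definition fork : sgraph := SGraph fork_adj_sym fork_adj_irr.

Definition antifork : sgraph := compl fork.

Definition uncluttered (G : sgraph) : Prop :=
  forall S : {set G},
    ~ isomorphic (induced S) fork /\ ~ isomorphic (induced S) antifork.

Definition connected (G : sgraph) : Prop :=
  forall x y : G, connect (@adj G) x y.

Section Vertices.
Variable G : sgraph.

Definition complete (X Y : {set G}) : Prop :=
  forall x y, x \in X -> y \in Y -> adj x y.

Definition anticomplete (X Y : {set G}) : Prop :=
  forall x y, x \in X -> y \in Y -> ~~ adj x y.

Definition clique (X : {set G}) : Prop :=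
  forall x y, x \in X -> y \in X -> x != y -> adj x y.

Definition stable (X : {set G}) : Prop :=
  forall x y, x \in X -> y \in X -> ~~ adj x y.

Definition neighbours (v : G) : {set G} := [set w | adj v w].

Definition twins (u v : G) : Prop :=
  u != v /\ neighbours u :\: [set u; v] = neighbours v :\: [set u; v].

Definition simplicial (v : G) : Prop := clique (neighbours v).

End Vertices.

Definition has_adjacent_simplicial_twins (G : sgraph) : Prop :=
  exists u v : G, [/\ adj u v, twins u v, simplicial u & simplicial v].

Definition candelabrum_parts (H : sgraph) (k : nat) (Y Z : 'I_k -> {set H}) : Prop :=
  [/\ (forall i, Y i != set0) /\ (forall i, Z i != set0),
      [/\ forall i j, i != j -> [disjoint Y i & Y j],
          forall i j, i != j -> [disjoint Z i & Z j] &
          forall i j, [disjoint Y i & Z j]],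
      (\bigcup_i Y i) :|: (\bigcup_i Z i) = [set: H],
      (forall i, clique (Y i)) /\ (forall i, stable (Z i)) &
      [/\ forall i j : 'I_k, i < j -> anticomplete (Y i) (Y j),
          forall i j : 'I_k, i < j -> complete (Z i) (Z j),
          forall i, complete (Y i) (Z i) &
          forall i j, i != j -> anticomplete (Y i) (Z j)]].

Definition candelabrum (H : sgraph) (B : {set H}) : Prop :=
  exists (k : nat) (Y Z : 'I_k -> {set H}),
    [/\ 0 < k, candelabrum_parts Y Z & B = \bigcup_i Z i].

Definition candled (G : sgraph) : Prop :=
  exists (S : {set G}) (B : {set induced S}),
    [/\ candelabrum B,
        complete (val @: B) (~: S) &
        anticomplete (val @: (~: B)) (~: S)].

Definition is_line_graph_of_triangle_free (G : sgraph) : Prop :=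
  exists2 H : sgraph, triangle_free H & isomorphic G (line_graph H).

(* Main.v *)
Require Import Defs.
From mathcomp Require Import all_boot.

Set Implicit Arguments.
Unset Strict Implicit.
Unset Printing Implicit Defensive.

(* A graph is the line graph of a triangle-free graph iff it contains no claw and
   no diamond, so, when G and its complement are connected, one has to show that an
   uncluttered G with a claw or a diamond whose complement also has one falls
   under (2) or (3).  Call X a module if no vertex outside X splits X.

   If G has no nontrivial module, this situation is impossible.  A diamond D with
   a vertex a anticomplete to it leads, via the component of D among the vertices
   nonadjacent to a and complete to the common neighbours of a and D, to a
   nontrivial module; the same holds in the complement.  A claw together with two
   vertices anticomplete to it, or a four-cycle with a pendant and an isolated
   vertex, leaves a module that no further vertex can split.  Excluding these, no
   finite configuration contains one of claw, diamond and one of their complements;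
   this is a finite enumeration.

   If G has a nontrivial module, a suitable one yields an induced path p1 p2 p3 p4
   relative to which every other vertex is a twin of some p_i, complete to the path,
   anticomplete to it, or adjacent to exactly p2 and p3.  Such a structure is
   candled, in G or in the complement, or it spans a larger module.  The path comes
   from a maximal module that is neither a clique nor stable, or, if there is none
   and (2) fails, from pairs of adjacent and of nonadjacent twins. *)

(** Primeness and connectedness are global, so a bounded search cannot use them as they stand. Two
    devices bridge the gap: [exts] lists the rows with which a new vertex can attach to known
    vertices without creating a forbidden five-vertex configuration, and [sealed] says that none of
    these rows splits a given set, which is then a module of the whole graph, however many vertices
    remain unseen. For a diamond the module is instead a whole anticomponent, reached by induction.
    The exclusions are staged: what one stage excludes is forbidden in the next, which keeps the
    later lists of rows short. Each list of forbidden configurations is closed under complement, so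
    every exclusion can be used in both graphs. A four-vertex path with its ends blown up into
    cliques and its inner vertices into stable sets is a candelabrum with two pairs of parts.
    Further pairs arise from edges between vertices anticomplete to the path and vertices adjacent
    to exactly [p2] and [p3], which is why these two kinds must be controlled. *)

(** * Configurations *)

(* A configuration lists, for each vertex of a sequence, its adjacencies to
   the vertices that come later in the sequence. *)
Definition conf := seq (seq bool).

Fixpoint conf_of (G : sgraph) (vs : seq G) : conf :=
  if vs is v :: vs' then [seq adj v u | u <- vs'] :: conf_of vs' else [::].

Fixpoint subconf (m : bitseq) (c : conf) : conf :=
  match m, c with
  | b :: m', r :: c' => if b then mask m' r :: subconf m' c' else subconf m' c'
  | _, _ => [::]
  end.

Fixpoint cadj (c : conf) (i j : nat) : bool :=
  match c, i, j with
  | r :: _, 0, j'.+1 => nth false r j'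
  | r :: _, i'.+1, 0 => nth false r i'
  | _ :: c', i'.+1, j'.+1 => cadj c' i' j'
  | _, _, _ => false
  end.

Fixpoint conf_at (c : conf) (s : seq nat) : conf :=
  if s is i :: s' then [seq cadj c i j | j <- s'] :: conf_at c s' else [::].

(** Vertices are placed last first, so that a row is compared with vertices already placed. The
    conditionals, here and in later searches, skip the branch not taken, whereas [vm_compute]
    evaluates both arguments of a boolean connective. *)
Fixpoint embeddings (H c : conf) : seq (seq nat) :=
  if H is r :: H' then
    flatten [seq [seq i :: s | i <- iota 0 (size c) &
                    if i \in s then false else [seq cadj c i j | j <- s] == r]
            | s <- embeddings H' c]
  else [:: [::]].

Definition embeds (H c : conf) : bool := ~~ nilp (embeddings H c).

Definition has_conf (G : sgraph) (H : conf) : Prop :=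
  exists2 vs : seq G, uniq vs & conf_of vs = H.

Lemma size_conf_of (G : sgraph) (vs : seq G) : size (conf_of vs) = size vs.
Proof. by elim: vs => //= v vs ->. Qed.

Lemma conf_of_mask (G : sgraph) (m : bitseq) (vs : seq G) :
  conf_of (mask m vs) = subconf m (conf_of vs).
Proof.
elim: vs m => [|v vs IH] [|[] m] //=; first by rewrite IH map_mask.
Qed.

Lemma cadj_conf_of (G : sgraph) (x0 : G) (vs : seq G) i j :
  i < size vs -> j < size vs ->
  cadj (conf_of vs) i j = adj (nth x0 vs i) (nth x0 vs j).
Proof.
elim: vs i j => [|v vs IH] [|i] [|j] //=; rewrite ?ltnS.
- by rewrite adj_irr.
- by move=> _ ltj; rewrite (nth_map x0).
- by move=> lti _; rewrite (nth_map x0) // adj_sym.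
- exact: IH.
Qed.

Lemma conf_at_conf_of (G : sgraph) (x0 : G) (vs : seq G) s :
  all (fun i => i < size vs) s ->
  conf_at (conf_of vs) s = conf_of [seq nth x0 vs i | i <- s].
Proof.
elim: s => //= i s IH /andP[lti lts]; rewrite -IH // -map_comp; congr (_ :: _).
by apply/eq_in_map => j js /=; rewrite (cadj_conf_of x0) //; apply: (allP lts).
Qed.

Lemma embeddingsP (H c : conf) s :
  s \in embeddings H c ->
  [/\ uniq s, all (fun i => i < size c) s & conf_at c s = H].
Proof.
elim: H s => [|r H IH] s /=; first by rewrite inE => /eqP->.
case/flatten_mapP=> t /IH[ut lt ct] /mapP[i]; rewrite mem_filter mem_iota add0n /=.
case: ifP => // nit /andP[/eqP ri lti] -> /=; split.
- by rewrite nit.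
- by rewrite lti.
- by rewrite ri ct.
Qed.

Lemma embeds_conf_of (G : sgraph) (H : conf) (vs : seq G) :
  uniq vs -> embeds H (conf_of vs) -> has_conf G H.
Proof.
move=> uvs; rewrite /embeds; case E: (embeddings _ _) => [|s l] // _.
have /embeddingsP[us]: s \in embeddings H (conf_of vs) by rewrite E mem_head.
rewrite size_conf_of => ls cs.
case: vs => [|x0 vs] in uvs ls cs E *.
  by exists [::] => //; rewrite -cs; case: s ls us cs E.
exists [seq nth x0 (x0 :: vs) i | i <- s]; last by rewrite -conf_at_conf_of.
rewrite map_inj_in_uniq // => i j iS jS /eqP.
by rewrite nth_uniq ?(allP ls) // => /eqP.
Qed.

(** * Extensions of a configuration by one vertex *)

(** A decision tree over the bits of a key; [node] collapses subtrees that are false throughout, so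
    that a walk may settle a case before the key ends. *)
Inductive trie := Leaf of bool | Node of trie & trie.

Definition node (l r : trie) : trie :=
  match l, r with Leaf false, Leaf false => Leaf false | _, _ => Node l r end.

Fixpoint build (n : nat) (f : bitseq -> bool) : trie :=
  if n is n'.+1 then
    node (build n' (fun l => f (false :: l))) (build n' (fun l => f (true :: l)))
  else Leaf (f [::]).

Fixpoint walk (t : trie) (l : bitseq) : trie :=
  match l, t with
  | b :: l', Node l r => walk (if b then r else l) l'
  | _, _ => t
  end.

Definition truth (t : trie) : bool := if t is Leaf b then b else false.

(** One implication suffices: rows are discarded only where the table answers true. *)
Lemma walk_build n f l : size l = n -> truth (walk (build n f) l) -> f l.
Proof.
elim: n f l => [|n IH] f [|b l] //= [sl].
have step u v : truth (walk (node u v) (b :: l)) ->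
    truth (walk (if b then v else u) l).
  by case: u => [[]|u1 u2]; case: v => [[]|v1 v2] //=; case: b; case: l {sl}.
by move/step; case: b {step} => /= h;
  [apply: (IH (fun l => f (true :: l))) h | apply: (IH (fun l => f (false :: l))) h].
Qed.

Lemma walk_cat t l1 l2 : walk t (l1 ++ l2) = walk (walk t l1) l2.
Proof.
elim: l1 t => [|b l1 IH] [c|l r] //=.
by case: (l2).
Qed.

(* The key of a five-vertex configuration [r :: c] is [flatten c ++ r]. *)
Definition table (Hs : seq conf) : trie :=
  build 10 (fun l =>
    has (fun H => embeds H (drop 6 l :: reshape [:: 3; 2; 1; 0] (take 6 l))) Hs).

Lemma tableP Hs l : size l = 10 -> truth (walk (table Hs) l) ->
  has (fun H => embeds H (drop 6 l :: reshape [:: 3; 2; 1; 0] (take 6 l))) Hs.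
Proof. by move=> sl; rewrite /table; move: 10 sl => n sl /(walk_build sl). Qed.

Fixpoint bitseqs (n : nat) : seq bitseq :=
  if n is n'.+1 then
    [seq false :: l | l <- bitseqs n'] ++ [seq true :: l | l <- bitseqs n']
  else [:: [::]].

Fixpoint masks (k n : nat) : seq bitseq :=
  match k, n with
  | k'.+1, n'.+1 => [seq true :: m | m <- masks k' n'] ++ [seq false :: m | m <- masks k n']
  | 0, _ => [:: nseq n false]
  | _, 0 => [::]
  end.

(** The first six bits of a key depend only on the four old vertices, so that part of the walk is
    made once per mask and shared by all rows; masks already at [Leaf false] are dropped. *)
Definition exts (tbl : trie) (c : conf) : seq bitseq :=
  let cs := [seq (m, walk tbl (flatten (subconf m c))) | m <- masks 4 (size c)] in
  let cs' := [seq x <- cs | if x.2 is Leaf false then false else true] in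
  [seq p <- bitseqs (size c) | ~~ has (fun x => truth (walk x.2 (mask x.1 p))) cs'].

Lemma mem_bitseqs l : l \in bitseqs (size l).
Proof.
elim: l => //= b l IH; rewrite mem_cat; apply/orP.
by case: b; [right|left]; apply: map_f.
Qed.

Lemma size_masks k n m : m \in masks k n -> size m = n /\ count id m = k.
Proof.
elim: n k m => [|n IH] [|k] m //=.
- by rewrite inE => /eqP->.
- by rewrite inE => /eqP-> /=; rewrite size_nseq count_nseq mul0n.
by rewrite mem_cat => /orP[] /mapP[m' /IH[sm cm] ->] /=; rewrite sm cm.
Qed.

Lemma shape_conf_of (G : sgraph) (vs : seq G) :
  shape (conf_of vs) = rev (iota 0 (size vs)).
Proof.
elim: vs => [|v vs IH] //; rewrite [size _]/= -addn1 iotaD rev_cat /= -IH.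
by rewrite /shape /= size_map.
Qed.

(** A row is filtered out only if [v] and four old vertices embed a forbidden configuration, which
    [G] does not have. *)
Lemma exts_mem (G : sgraph) (Hs : seq conf) (v : G) (vs : seq G) :
  (forall H, H \in Hs -> ~ has_conf G H) -> uniq (v :: vs) ->
  [seq adj v u | u <- vs] \in exts (table Hs) (conf_of vs).
Proof.
move=> noH uvs; rewrite mem_filter size_conf_of -{2}(size_map (adj v) vs) mem_bitseqs.
rewrite andbT; apply/negP.
have has_sub (T : Type) (a b : pred T) s : has a (filter b s) -> has a s.
  by elim: s => //= x s IH; case: (b x) => /= [/orP[->|/IH->]|/IH->]; rewrite ?orbT.
move/has_sub; rewrite has_map => /hasP[m'].
move/size_masks=> [sm cm] /=.
rewrite -conf_of_mask -walk_cat -map_mask.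
set ws := mask m' vs; have sws : size ws = 4 by rewrite size_mask.
have uws : uniq (v :: ws).
  move: uvs => /= /andP[nv uv]; rewrite mask_uniq // andbT.
  by apply: contra nv => /mem_mask.
have sfl : size (flatten (conf_of ws)) = 6.
  by rewrite size_flatten shape_conf_of sws.
move/tableP => /(_ _)/hasP[]; first by rewrite size_cat sfl size_map sws.
move=> H inH; rewrite drop_size_cat // take_size_cat //.
have -> : [:: 3; 2; 1; 0] = shape (conf_of ws) by rewrite shape_conf_of sws.
by rewrite flattenK => /(@embeds_conf_of G H (v :: ws) uws)/(noH _ inH).
Qed.

(** * Named configurations and complementation *)

Definition conf_on (n : nat) (es : seq (nat * nat)) : conf :=
  [seq [seq ((i, j) \in es) || ((j, i) \in es) | j <- iota i.+1 (n - i.+1)]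
  | i <- iota 0 n].

Definition coconf (c : conf) : conf := [seq map negb r | r <- c].

Definition fork_conf := conf_on 5 fork_edges.
Definition claw := conf_on 4 [:: (0, 1); (0, 2); (0, 3)].
(** The nonadjacent pair is 2, 3; later masks and forks rely on this numbering. *)
Definition diamond := conf_on 4 [:: (0, 1); (0, 2); (0, 3); (1, 2); (1, 3)].
Definition diamond_K1 := conf_on 5 [:: (0, 1); (0, 2); (0, 3); (1, 2); (1, 3)].
Definition claw_2K1 := conf_on 6 [:: (0, 1); (0, 2); (0, 3)].
Definition claw_K2 := conf_on 6 [:: (0, 1); (0, 2); (0, 3); (4, 5)].
(** The four-cycle 0, 1, 4, 2 with the pendant vertex 3 at 0. *)
Definition banner := conf_on 5 [:: (0, 1); (0, 2); (0, 3); (1, 4); (2, 4)].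
Definition banner_K1 := conf_on 6 [:: (0, 1); (0, 2); (0, 3); (1, 4); (2, 4)].

Lemma conf_of_compl (G : sgraph) (vs : seq G) :
  uniq vs -> @conf_of (compl G) vs = coconf (conf_of vs).
Proof.
elim: vs => //= v vs IH /andP[nv uv]; rewrite IH // -map_comp; congr (_ :: _).
apply/eq_in_map => u uin /=; rewrite /compl_adj.
by case: eqP nv => [->|//]; rewrite uin.
Qed.

Lemma coconfK : involutive coconf.
Proof.
move=> c; rewrite /coconf -map_comp -[RHS]map_id; apply: eq_map => r /=.
by rewrite -map_comp -[RHS]map_id; apply: eq_map => b /=; rewrite negbK.
Qed.

Lemma has_conf_compl (G : sgraph) H : has_conf (compl G) H <-> has_conf G (coconf H).
Proof.
split=> -[vs uvs cvs]; exists vs => //.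
  by rewrite -cvs conf_of_compl // coconfK.
by rewrite conf_of_compl // cvs coconfK.
Qed.

Lemma has_conf_induced (G : sgraph) (vs : seq G) (H : sgraph) n (e : H -> 'I_n) :
  uniq vs -> size vs = n -> bijective e ->
  (forall i j, adj i j = cadj (conf_of vs) (e i) (e j)) ->
  isomorphic (induced [set v in vs]) H.
Proof.
move=> uvs svs [e' eK e'K] adjE.
have ltx (x : {x : G | x \in [set v in vs]}) : index (val x) vs < n.
  by rewrite -svs index_mem; move: (valP x); rewrite inE.
exists (fun x => e' (Ordinal (ltx x))); last first.
  move=> x y; rewrite adjE !e'K /= (cadj_conf_of (val x)) ?svs ?ltx //.
  by rewrite !nth_index //; [move: (valP y)|move: (valP x)]; rewrite inE.
have memx (i : 'I_n) : tnth (Tuple (introT eqP svs)) i \in [set v in vs].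
  by rewrite inE mem_tnth.
exists (fun y => exist (fun x => x \in [set v in vs]) _ (memx (e y))) => [x|y].
  apply: val_inj; rewrite /= e'K (tnth_nth (val x)) /= nth_index //.
  by move: (valP x); rewrite inE.
apply: (can_inj eK); rewrite e'K; apply: val_inj => /=.
have v0 : G by apply: (tnth (Tuple (introT eqP svs)) (e y)).
by rewrite (tnth_nth v0) /= index_uniq // svs.
Qed.

Lemma uncluttered_no_fork (G : sgraph) : uncluttered G -> ~ has_conf G fork_conf.
Proof.
move=> hG [vs uvs cvs]; have [+ _] := hG [set v in vs]; apply.
have svs : size vs = 5 by rewrite -size_conf_of cvs.
apply: (@has_conf_induced G vs fork 5 id uvs svs); first by exists id.
by rewrite cvs => -[[|[|[|[|[|i]]]]] lti] // [[|[|[|[|[|j]]]]] ltj].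
Qed.

Lemma uncluttered_no_antifork (G : sgraph) : uncluttered G -> ~ has_conf G (coconf fork_conf).
Proof.
move=> hG [vs uvs cvs]; have [_ +] := hG [set v in vs]; apply.
have svs : size vs = 5 by rewrite -size_conf_of cvs.
apply: (@has_conf_induced G vs antifork 5 id uvs svs); first by exists id.
by rewrite cvs => -[[|[|[|[|[|i]]]]] lti] // [[|[|[|[|[|j]]]]] ltj].
Qed.

Definition forks := [:: fork_conf; coconf fork_conf].

Definition fork_free (G : sgraph) : Prop := forall H, H \in forks -> ~ has_conf G H.

Lemma uncluttered_fork_free (G : sgraph) : uncluttered G -> fork_free G.
Proof.
move=> hG H; rewrite !inE => /orP[]/eqP->.
  exact: uncluttered_no_fork.
exact: uncluttered_no_antifork.
Qed.

Lemma fork_free_compl (G : sgraph) : fork_free G -> fork_free (compl G).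
Proof.
move=> hG H inH /has_conf_compl; apply: hG; move: inH; rewrite !inE.
by move=> /orP[]/eqP->; rewrite ?coconfK eqxx ?orbT.
Qed.

Definition fork_table := Eval vm_compute in table forks.

Lemma fork_exts (G : sgraph) (v : G) (vs : seq G) :
  fork_free G -> uniq (v :: vs) ->
  [seq adj v u | u <- vs] \in exts fork_table (conf_of vs).
Proof. 
move=> hG uvs; have := exts_mem hG uvs.
have -> : table forks = fork_table by vm_cast_no_check (erefl fork_table).
by [].
Qed.

(** * Refutation by exhaustive search *)

Section Refute.
Variables (tbl : trie) (Hs : seq conf).

(* Tries to realize the rows of a configuration, last vertex first, on old or
   new vertices; [s] records the positions in [c] of the vertices chosen so far. *)
Fixpoint refute (rows : conf) (s : seq nat) (c : conf) : bool :=
  if rows is r :: rows' then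
    all (fun i => if i \in s then true
                  else if [seq cadj c i j | j <- s] == r
                       then refute rows' (i :: s) c else true)
        (iota 0 (size c)) &&
    all (fun p => if [seq nth false p j | j <- s] == r then
                    if has (fun H => embeds H (p :: c)) Hs then true
                    else refute rows' (0 :: map S s) (p :: c)
                  else true)
        (exts tbl c)
  else false.

(** The search can follow any actual realization: its next vertex either occurs in [vs], or is new
    and its row survives in [exts]. When the rows run out [refute] answers false, so the answer true
    excludes every realization. Here [ws1] is the part already placed and [ws2] the part still to
    come, last vertex first. *)
Lemma refuteP (G : sgraph) :
  (forall H, H \in Hs -> ~ has_conf G H) ->
  (forall (v : G) vs, uniq (v :: vs) ->
     [seq adj v u | u <- vs] \in exts tbl (conf_of vs)) ->
  forall rows s (x0 : G) (vs ws1 ws2 : seq G),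
  uniq vs -> uniq (catrev ws2 ws1) -> all (fun i => i < size vs) s ->
  ws1 = [seq nth x0 vs i | i <- s] ->
  catrev rows (conf_of ws1) = conf_of (catrev ws2 ws1) ->
  size rows = size ws2 -> ~ refute rows s (conf_of vs).
Proof.
move=> noH ext; elim=> //= r rows IH s x0 vs ws1 [//|w ws2] uvs uws ls ews eqc [sz].
have cE : catrev (r :: rows) (conf_of ws1) = catrev rows (r :: conf_of ws1) by [].
have rE : r = [seq adj w u | u <- ws1].
  move: eqc; rewrite /= !catrevE.
  have drop_conf t1 t2 : drop (size t1) (conf_of (t1 ++ t2)) = @conf_of G t2.
    by elim: t1 => [|x t1 IHt] /=; rewrite ?drop0.
  move/(congr1 (drop (size (rev rows)))); rewrite drop_size_cat //.
  by rewrite size_rev sz -size_rev drop_conf => -[].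
have uw : w \notin ws1.
  by move: uws; rewrite /= catrevE cat_uniq => /and3P[_ _ /andP[]].
case/andP=> /allP old /allP new; case: (boolP (w \in vs)) => win.
  have iw : index w vs < size vs by rewrite index_mem.
  have ni : index w vs \notin s.
    apply: contra uw => ins; rewrite ews; apply/mapP; exists (index w vs) => //. by rewrite nth_index.
  have := old (index w vs); rewrite mem_iota add0n size_conf_of => /(_ iw).
  rewrite (negbTE ni) ifT.
    move: IH => /(_ (index w vs :: s) x0 vs (w :: ws1) ws2); apply=> //=.
    - by rewrite iw.
    - by rewrite nth_index // -ews.
    - by rewrite -rE.
  apply/eqP; rewrite rE ews -map_comp; apply/eq_in_map => j js /=.
  by rewrite (cadj_conf_of x0) ?nth_index //; apply: (allP ls).
have uwvs : uniq (w :: vs) by rewrite /= win.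
have := new _ (ext w vs uwvs); rewrite ifT; last first.
  apply/eqP; rewrite rE ews -map_comp; apply/eq_in_map => j js /=.
  by rewrite (nth_map x0) //; apply: (allP ls).
case: ifP => [/hasP[H inH]|_]; first by move/(@embeds_conf_of G H (w :: vs) uwvs)/(noH _ inH).
(* The new vertex takes position 0, which shifts all recorded positions by one. *)
move: IH => /(_ (0 :: map S s) x0 (w :: vs) (w :: ws1) ws2); apply=> //=.
- by rewrite all_map; apply: sub_all ls => j /=.
- by rewrite -map_comp ews.
- by rewrite -rE.
Qed.

End Refute.

(* Positions outside [E] carrying equal vertices would have equal rows. *)
Definition separated (E : seq (nat * nat)) (c : conf) : bool :=
  let n := size c in
  all (fun j => all (fun i => ((i, j) \in E) || cadj c i j ||
    has (fun k => cadj c k i != cadj c k j) (iota 0 n)) (iota 0 j)) (iota 0 n).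

Lemma separated_uniq (G : sgraph) (x0 : G) (E : seq (nat * nat)) (vs : seq G) :
  all (fun ij => nth x0 vs ij.1 != nth x0 vs ij.2) E ->
  separated E (conf_of vs) -> uniq vs.
Proof.
move=> nE /allP sep; apply: negbNE; apply/(uniqPn x0) => -[i [j [ij js eij]]].
have := sep j; rewrite mem_iota add0n size_conf_of => /(_ js)/allP/(_ i).
rewrite mem_iota add0n => /(_ ij)/orP[/orP[/(allP nE)|]|/hasP[k]].
- by rewrite eij eqxx.
- by rewrite (cadj_conf_of x0) ?(ltn_trans ij js) // eij adj_irr.
rewrite mem_iota add0n => ks.
by rewrite !(cadj_conf_of x0) ?(ltn_trans ij js) // eij eqxx.
Qed.

Section ForkFree.
Variables (G : sgraph) (hG : fork_free G).
Implicit Types a b c d e : G.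

(** The leaves [a] and [e] are nonadjacent twins of the fork, the one pair whose distinctness the
    adjacencies do not force. *)
Lemma no_fork a b c d e : a != e ->
  adj a b -> adj b c -> adj c d -> adj b e ->
  ~~ adj a c -> ~~ adj a d -> ~~ adj a e -> ~~ adj b d -> ~~ adj c e -> ~~ adj d e ->
  False.
Proof.
move=> ae ab bc cd be ac ad ae' bd ce de.
have cE : conf_of [:: a; b; c; d; e] = fork_conf.
  by rewrite /= ab bc cd be (negbTE ac) (negbTE ad) (negbTE ae') (negbTE bd)
    (negbTE ce) (negbTE de).
apply: (hG (mem_head _ _)); exists [:: a; b; c; d; e] => //.
by apply: (@separated_uniq _ a [:: (0, 4)]); rewrite ?cE //= andbT.
Qed.

(** In the complement the vertices form the path [b], [d], [a], [c] with [e] attached to [d], whence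
    the order of the list. *)
Lemma no_antifork a b c d e :
  adj a b -> adj b c -> adj c d -> adj a e -> adj b e -> adj c e ->
  ~~ adj a c -> ~~ adj a d -> ~~ adj b d -> ~~ adj d e -> False.
Proof.
move=> ab bc cd ae be ce ac ad bd de.
have cE : conf_of [:: b; d; a; c; e] = coconf fork_conf.
  by rewrite /= [adj b a]adj_sym [adj d a]adj_sym [adj d c]adj_sym ab bc cd ae be ce
    (negbTE ac) (negbTE ad) (negbTE bd) (negbTE de).
apply: (@hG (coconf fork_conf)); first by rewrite !inE eqxx orbT.
exists [:: b; d; a; c; e] => //.
by apply: (@separated_uniq _ a [::]); rewrite ?cE.
Qed.

End ForkFree.

(** * Modules *)

Definition is_module (G : sgraph) (X : {set G}) : bool :=
  [forall v, (v \notin X) ==> [forall x in X, forall y in X, adj v x == adj v y]].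

Lemma moduleP (G : sgraph) (X : {set G}) :
  reflect (forall v x y, v \notin X -> x \in X -> y \in X -> adj v x = adj v y)
          (is_module X).
Proof.
apply: (iffP forallP) => [mX v x y nv xX yX|mX v].
  have := mX v; rewrite nv => /forallP/(_ x); rewrite xX => /forallP/(_ y).
  by rewrite yX => /eqP.
apply/implyP=> nv; apply/forallP=> x; apply/implyP=> xX; apply/forallP=> y.
by apply/implyP=> yX; apply/eqP/mX.
Qed.

Lemma is_module_compl (G : sgraph) (X : {set G}) : @is_module (compl G) X = is_module X.
Proof.
have cE (v x : G) : v \notin X -> x \in X -> @adj (compl G) v x = ~~ adj v x.
  by move=> nv xX; rewrite /= /compl_adj; case: eqP nv => // ->; rewrite xX.
apply/moduleP/moduleP => mX v x y nv xX yX; have := mX v x y nv xX yX.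
  by rewrite !cE // => /negb_inj.
by rewrite !cE // => ->.
Qed.

Definition prime_graph (G : sgraph) : Prop :=
  forall X : {set G}, is_module X -> 1 < #|X| -> X = [set: G].

Lemma prime_graph_compl (G : sgraph) : prime_graph G -> prime_graph (compl G).
Proof. by move=> pG X; rewrite is_module_compl; apply: pG. Qed.

Definition constant_on (m p : bitseq) : bool := constant (mask m p).

(** A finite certificate for a module: neither the other vertices of [c] nor any vertex that could
    ever be added splits the marked set. The strict bound by [size c] makes this set proper in every
    graph containing [c]. *)
Definition sealed (tbl : trie) (c : conf) (m : bitseq) : bool :=
  [&& size m == size c, 1 < count id m, count id m < size c,
      all (fun i => nth false m i ||
                    constant_on m [seq cadj c i j | j <- iota 0 (size c)])
          (iota 0 (size c)) &
      all (constant_on m) (exts tbl c)].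

Lemma mem_mask_nth (T : eqType) (x0 : T) (m : bitseq) (s : seq T) i :
  nth false m i -> i < size s -> nth x0 s i \in mask m s.
Proof.
elim: s m i => [|u s IH] [|b m] [|i] //=; first by move=> ->; rewrite mem_head.
by rewrite ltnS => h /(IH _ _ h); case: b => //; rewrite inE orbC => ->.
Qed.

Lemma sealed_not_prime (G : sgraph) (tbl : trie) (vs : seq G) (m : bitseq) :
  (forall (v : G) vs, uniq (v :: vs) ->
     [seq adj v u | u <- vs] \in exts tbl (conf_of vs)) ->
  prime_graph G -> uniq vs -> ~~ sealed tbl (conf_of vs) m.
Proof.
move=> ext pG uvs; apply/negP; rewrite /sealed size_conf_of.
case/and5P=> /eqP sm lt1 ltn /allP inC /allP outC.
have um : uniq (mask m vs) by rewrite mask_uniq.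
have cX : #|[set v in mask m vs]| = count id m.
  by rewrite cardsE; move/card_uniqP: um => ->; rewrite size_mask.
have mX : is_module [set v in mask m vs].
  apply/moduleP => v x y; rewrite !inE => nv xin yin.
  have : constant_on m [seq adj v u | u <- vs].
    case: (boolP (v \in vs)) => vin; last by apply: outC; apply: ext; rewrite /= vin.
    have iv : index v vs < size vs by rewrite index_mem.
    have := inC (index v vs); rewrite mem_iota add0n => /(_ iv)/orP[nm|].
      by case/negP: nv; have := mem_mask_nth v nm iv; rewrite nth_index.
    set r := map _ _; set r' := map _ _; suff -> : r = r' by [].
    apply: (@eq_from_nth _ false); rewrite !size_map size_iota // => j js.
    rewrite !(nth_map 0) ?size_iota // (nth_map v) // nth_iota // add0n.
    by rewrite (cadj_conf_of v) // nth_index.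
  rewrite /constant_on -map_mask; case E: (mask m vs) xin yin => [//|z zs] /=.
  move=> xin yin /allP h; have hz u : u \in z :: zs -> adj v u = adj v z.
    by rewrite inE => /orP[/eqP->//|uin]; apply/eqP/h/map_f.
  by rewrite !hz.
have := pG _ mX; rewrite cX => /(_ lt1) XT.
have : #|[set: G]| <= count id m by rewrite -XT cX.
rewrite leqNgt; apply/negP; rewrite negbK; apply: (leq_trans ltn).
by rewrite -(card_uniqP uvs) cardsT max_card.
Qed.

(** * Components of the complement inside a set *)

Section Anticomponents.
Variables (G : sgraph) (S : {set G}).

Definition anticomp (x : G) : {set G} :=
  [set y | connect (fun y z => [&& ~~ adj y z, y \in S & z \in S]) x y].

Lemma anticomp_refl x : x \in anticomp x.
Proof. by rewrite inE connect0. Qed.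

Lemma anticomp_sub x : x \in S -> anticomp x \subset S.
Proof.
move=> xS; apply/subsetP => y; rewrite inE => /connectP[p].
by elim: p x xS => [|z p IH] x xS /=; [move=> _ ->|case/andP=> /and3P[_ _ /IH]].
Qed.

Lemma anticomp_step x y z :
  x \in S -> y \in anticomp x -> z \in S -> ~~ adj y z -> z \in anticomp x.
Proof.
move=> xS yC zS yz; have yS := subsetP (anticomp_sub xS) _ yC.
move: yC; rewrite !inE => /connect_trans; apply; apply: connect1.
by rewrite yz yS.
Qed.

Lemma anticomp_invariant x (f : pred G) : x \in S ->
  {in S &, forall y z, ~~ adj y z -> f y = f z} -> {in anticomp x, forall y, f y = f x}.
Proof.
move=> xS fE y; rewrite inE => /connectP[p].
elim: p x xS => [|z p IH] x xS /=; first by move=> _ ->.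
case/andP=> /and3P[xz _ zS] pz yE; rewrite (IH z) //.
by apply: fE; rewrite // adj_sym.
Qed.

(** A vertex of [S] outside the anticomponent is complete to it; a vertex outside [S] treats both
    ends of each nonadjacent pair alike, hence the whole anticomponent. *)
Lemma anticomp_module x : x \in S ->
  (forall v, v \notin S -> {in S &, forall y z, ~~ adj y z -> adj v y = adj v z}) ->
  is_module (anticomp x).
Proof.
move=> xS outS; apply/moduleP => v y z nv yC zC.
case: (boolP (v \in S)) => vS; last first.
  by rewrite (anticomp_invariant xS (outS v vS) yC) (anticomp_invariant xS (outS v vS) zC).
have compl u : u \in anticomp x -> adj v u.
  move=> uC; apply/negPn/negP => uv; case/negP: nv.
  by apply: anticomp_step uC vS _; rewrite // adj_sym.
by rewrite !compl.
Qed.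

End Anticomponents.

Lemma connected_crossing (G : sgraph) (T : {set G}) (x y : G) :
  connected G -> x \in T -> y \notin T ->
  exists t w, [/\ t \in T, w \notin T & adj t w].
Proof.
move=> cG xT yT; case: (pickP (fun p : G * G => [&& p.1 \in T, p.2 \notin T & adj p.1 p.2])).
  by move=> [t w] /and3P[*]; exists t, w.
move=> none; have clT : closed (@adj G) (mem T).
  apply: intro_closed => [|u v uv uT]; first exact/sym_connect_sym/adj_sym.
  by have := none (u, v); rewrite /= uT uv andbT => /negbFE.
by case/negP: yT; have := closed_connect clT (cG x y); rewrite xT => <-.
Qed.

Definition anti (G : sgraph) (x : G) (D : seq G) : bool := ~~ has (adj x) D.

(** The second hypothesis says that [H] has no isolated vertex, so no member of [D] misses all of
    [D]. *)
Lemma anti_notin (G : sgraph) (H : conf) (D : seq G) x :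
  conf_of D = H -> 
  all (fun i => has (fun j => cadj H i j) (iota 0 (size H))) (iota 0 (size H)) ->
  anti x D -> x \notin D.
Proof.
move=> cD /allP nz; apply: contra => xD; have ix : index x D < size D by rewrite index_mem.
have := nz (index x D); rewrite mem_iota add0n -cD size_conf_of => /(_ ix)/hasP[j].
rewrite mem_iota add0n => js; rewrite (cadj_conf_of x) // nth_index // => xj.
by apply/hasP; exists (nth x D j) => //; rewrite mem_nth.
Qed.

Lemma anti_map (G : sgraph) (D : seq G) x : anti x D -> [seq adj x u | u <- D] = nseq (size D) false.
Proof.
elim: D => //= u D IH; rewrite /anti /= negb_or => /andP[/negbTE-> /IH->] //.
Qed.

(** * Diamonds in prime graphs *)

Section PrimeDiamond.
Variables (G : sgraph) (hG : fork_free G) (pG : prime_graph G) (cG : connected G).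

(** Every other row of [w] seals the last two vertices of [D], the nonadjacent pair of the
    diamond. *)
Lemma diamond_attach (D : seq G) a w :
  uniq D -> conf_of D = diamond -> anti a D -> adj w a ->
  all (adj w) D || anti w D.
Proof.
move=> uD cD aD wa.
have naD : a \notin D by apply: anti_notin cD _ aD.
have nwD : w \notin D.
  by apply: contra aD => wD; apply/hasP; exists w => //; rewrite adj_sym.
have sD : size D = 4 by rewrite -size_conf_of cD.
have uaD : uniq (a :: D) by rewrite /= naD.
have uwaD : uniq (w :: a :: D).
  by rewrite /= inE negb_or nwD naD uD (contraTneq _ wa) // => ->; rewrite adj_irr.
have cw : conf_of (w :: a :: D) = [seq adj w u | u <- a :: D] :: nseq 4 false :: diamond.
  by rewrite /= cD (anti_map aD) sD.
have := fork_exts hG uwaD; rewrite [conf_of (a :: D)]/= cD (anti_map aD) sD.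
have chk : all (fun p => head false p ==> [|| all id (behead p), ~~ has id (behead p) |
      sealed fork_table (p :: nseq 4 false :: diamond) [:: false; false; false; false; true; true]])
    (exts fork_table (nseq 4 false :: diamond)) by vm_compute.
move/(allP chk); rewrite /= wa /= all_map has_map => /or3P[h|h|].
- by apply/orP; left; apply: sub_all h.
- by apply/orP; right; apply: contra h; apply: sub_has.
have ext v vs := @fork_exts G v vs hG.
by have := sealed_not_prime [:: false; false; false; false; true; true] ext pG uwaD;
  rewrite cw /= wa => /negbTE ->.
Qed.

Variables (d0 d1 d2 d3 : G).
Let D := [:: d0; d1; d2; d3].
Hypotheses (uD : uniq D) (cD : conf_of D = diamond).

Let U (a : G) : {set G} := [set w | adj w a && all (adj w) D].
Let H (a : G) : {set G} := [set x | ~~ adj x a & [forall w in U a, adj w x]].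
Let X (a : G) : {set G} := [set x | connect (fun y z => adj y z && (z \in H a)) d0 x].

Let HP a x : reflect (~~ adj x a /\ {in U a, forall w, adj w x}) (x \in H a).
Proof.
rewrite inE; apply: (iffP andP) => -[xa h]; split=> //; [exact/forall_inP|].
exact/forall_inP.
Qed.

Let UP a w : reflect (adj w a /\ all (adj w) D) (w \in U a).
Proof. by rewrite inE; apply: andP. Qed.

Let D_in_H a x : anti a D -> x \in D -> x \in H a.
Proof.
move=> aD xD; apply/HP; split; last by move=> w /UP[_ /allP]; apply.
by apply: contra aD => xa; apply/hasP; exists x => //; rewrite adj_sym.
Qed.

Let adjD : [/\ adj d0 d1, adj d0 d2, adj d0 d3, adj d1 d2 & ~~ adj d2 d3].
Proof. by case: cD => -> -> -> -> _ ->. Qed.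

Let d23 : d2 != d3.
Proof. by case/and5P: uD => _ _; rewrite inE. Qed.

Let X_step a y z : y \in X a -> adj y z -> z \in H a -> z \in X a.
Proof.
rewrite !inE => yX yz zH; apply: connect_trans yX (connect1 _).
by rewrite yz inE.
Qed.

Let d0X a : d0 \in X a. Proof. by rewrite inE connect0. Qed.

Let D_in_X a x : anti a D -> x \in D -> x \in X a.
Proof.
move=> aD xD; have xH := D_in_H aD xD; have [h1 h2 h3 _ _] := adjD.
have /or4P xD' : [|| x == d0, x == d1, x == d2 | x == d3] by move: xD; rewrite !inE.
case: xD' xH => /eqP->; first by move=> _; apply: d0X.
all: exact: X_step (d0X a) _.
Qed.

Let X_sub a (T : {set G}) : d0 \in T ->
  (forall y z, y \in T -> y \in X a -> adj y z -> z \in H a -> z \in T) -> X a \subset T.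
Proof.
move=> d0T stepT; apply/subsetP => x; rewrite inE => /connectP[p].
have: d0 \in T :&: X a by rewrite inE d0T d0X.
elim: p (d0) => [|z p IH] y /=; first by rewrite inE => /andP[yT _] _ ->.
rewrite inE => /andP[yT yX] /andP[/andP[yz zH] pz]; apply: IH pz.
by rewrite inE (stepT y) //= (X_step yX).
Qed.

Let X_in_H a : anti a D -> X a \subset H a.
Proof. by move=> aD; apply: X_sub => // ; rewrite D_in_H ?mem_head. Qed.

(** Here [d2] and [d3] would be leaves at [t] of a fork continuing along [t], [w], [a]. *)
Let far_neighbour a w t : anti w D -> anti a D -> adj w a -> ~~ adj t a ->
  adj t w -> all (adj t) D -> False.
Proof.
have [_ _ _ _ h23] := adjD.
rewrite /anti /= !negb_or => /and5P[_ _ w2 w3 _] /and5P[_ _ a2 a3 _] wa ta tw.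
case/and5P=> _ _ t2 t3 _.
apply: (no_fork hG (a := d2) (b := t) (c := w) (d := a) (e := d3)) => //.
- by rewrite adj_sym.
- by rewrite adj_sym.
- by rewrite adj_sym.
Qed.

(** The anticomponent of [d2] in [X a] contains [d3] and misses [a], so primeness fails once it is a
    module. A vertex splitting a nonadjacent pair of [X a] gives a fork if it is nonadjacent to [a];
    otherwise induction on the size of [X a] applies. *)
Let no_good n a : #|X a| < n -> anti a D -> U a != set0 -> False.
Proof.
elim: n a => // n IH a; rewrite ltnS => leX aD /set0Pn[v vU].
have [h01 h02 h03 h12 h23] := adjD.
have XH := subsetP (X_in_H aD).
have UX w x : w \in U a -> x \in X a -> adj w x.
  by move=> wU /XH/HP[_]; apply.
have aX x : x \in X a -> ~~ adj x a by move/XH/HP=> [].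
have aNX : a \notin X a.
  have: X a \subset [set~ a].
    apply: X_sub => [|y z _ yX yz _]; rewrite in_setC1.
      by apply: contraNneq (anti_notin cD isT aD) => <-; rewrite mem_head.
    by apply: contraNneq (aX _ yX) => <-.
  by apply: contraL => aX'; apply/subsetPn; exists a; rewrite // in_setC1 eqxx.
have vX := UX v _ vU; have [va _] := UP a v vU.
(* If a neighbour [w] of [a] split [X a], a vertex [c2] of [X a] with no neighbour
   in [D] would have a smaller [X c2]. *)
have no_splitter w t m : adj w a -> t \in X a -> m \in X a -> adj w t -> ~~ adj w m -> False.
  move=> wa tX mX wt wm.
  have wD : anti w D.
    case/orP: (diamond_attach uD cD aD wa) => // wD; case/negP: wm; apply: UX => //.
    exact/UP.
  have tD : anti t D.
    have tw : adj t w by rewrite adj_sym.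
    case/orP: (diamond_attach uD cD wD tw) => // tD.
    by case: (far_neighbour wD aD wa (aX t tX) tw tD).
  (* On the way from [d0] to [t] inside [X a], some edge goes from a vertex meeting [D] to one
     anticomplete to [D]; by [diamond_attach] its first end is complete to [D]. *)
  have [c1 [c2 [c1X c2X c1D c2D c12]]] : exists c1 c2,
      [/\ c1 \in X a, c2 \in X a, all (adj c1) D, anti c2 D & adj c1 c2].
    case: (pickP (fun p : G * G => [&& p.1 \in X a, p.2 \in X a, all (adj p.1) D,
       anti p.2 D & adj p.1 p.2])) => [[c1 c2] /and5P[*]|none]; first by exists c1, c2.
    have TE x : (x \in [set x | ~~ anti x D]) = ~~ anti x D by rewrite inE.
    have : X a \subset [set x | ~~ anti x D].
      apply: X_sub => [|y z]; first by rewrite TE /anti negbK /= h01 orbT.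
      rewrite !TE => yD yX yz zH; apply/negP => zD.
      have zX : z \in X a by exact: (X_step yX yz zH).
      case/orP: (diamond_attach uD cD zD yz) => [yD'|]; last exact/negP.
      by have /negP[] := negbT (none (y, z)); apply/and5P; split.
    by move/subsetP/(_ t tX); rewrite TE tD.
  have c1U : c1 \in U c2 by apply/UP.
  have UU : U a \subset U c2.
    by apply/subsetP => u uU; apply/UP; rewrite UX //; case/UP: uU.
  (* As [U c2] contains [U a], a vertex of [H c2] can leave [H a] only by being adjacent to [a];
     then it is complete or anticomplete to [D], and both are impossible. *)
  have XX : X c2 \subset X a.
    apply: X_sub => // y z yX _ yz /HP[zc2 zU].
    apply: X_step yX yz _; apply/HP; split; last by move=> u /(subsetP UU)/zU.
    apply/negP => za; have c1z := zU _ c1U.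
    case/orP: (diamond_attach uD cD aD za) => zD.
      by case/negP: zc2; apply: UX => //; apply/UP.
    exact: (far_neighbour zD aD za (aX _ c1X) c1z c1D).
  apply: (IH c2) => //; last by apply/set0Pn; exists c1.
  apply: leq_trans leX; apply: proper_card; apply/properP; split=> //.
  by exists c1 => //; apply/negP => /(subsetP (X_in_H c2D))/HP[]; rewrite c12.
have no_split w x y : w \notin X a -> x \in X a -> y \in X a -> ~~ adj x y ->
    adj w x -> adj w y.
  move=> wX xX yX xy wx; apply/negPn/negP => wy.
  have wa : ~~ adj w a by apply/negP => wa; apply: (no_splitter w x y).
  (* Having a neighbour in [X a] but lying outside it, [w] is not in [H a]; being nonadjacent to
     [a], it misses some [u] of [U a], the centre of the fork below. *)
  have /HP wH : w \notin H a.
    by apply: contra wX => wH; apply: X_step xX _ wH; rewrite adj_sym.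
  have [u uU uw] : exists2 u, u \in U a & ~~ adj u w.
    apply/exists_inP; rewrite -negb_forall_in; apply/negP => /forall_inP h.
    by case: wH; split.
  have [ua _] := UP _ _ uU.
  apply: (no_fork hG (a := a) (b := u) (c := x) (d := w) (e := y)).
  - by apply: contraNneq aNX => E; rewrite {1}E.
  - by rewrite adj_sym.
  - exact: UX.
  - by rewrite adj_sym.
  - exact: UX.
  - by rewrite adj_sym aX.
  - by rewrite adj_sym.
  - by rewrite adj_sym aX.
  - exact: uw.
  - exact: xy.
  - exact: wy.
have d2X : d2 \in X a by apply: D_in_X; rewrite // !inE eqxx !orbT.
have d3X : d3 \in X a by apply: D_in_X; rewrite // !inE eqxx !orbT.
have mC : is_module (anticomp (X a) d2).
  apply: anticomp_module => // w wX y z yX zX yz; apply/idP/idP; first exact: no_split yz.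
  by apply: no_split; rewrite // adj_sym.
have d3C : d3 \in anticomp (X a) d2.
  by apply: anticomp_step h23; rewrite ?anticomp_refl.
have CT := pG mC; case/negP: aNX; apply: (subsetP (anticomp_sub d2X)).
rewrite CT ?inE //; apply/card_gt1P; exists d2, d3; rewrite anticomp_refl d3C.
by split.
Qed.
(** An edge [t w] leaving the set of vertices anticomplete to [D] makes [U t] nonempty, as [no_good]
    requires: [w] must be complete to [D]. *)
Lemma pendant_diamond a : anti a D -> False.
Proof.
move=> aD; have naD := anti_notin cD isT aD.
have [||t [w [tA wA tw]]] := @connected_crossing G [set x | anti x D] a d0 cG.
- by rewrite inE.
- by rewrite inE /anti negbK /=; case: adjD => -> *; rewrite orbT.
rewrite !inE in tA wA; apply: (no_good (ltnSn _) tA).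
apply/set0Pn; exists w; apply/UP; have wt : adj w t by rewrite adj_sym.
split=> //; case/orP: (diamond_attach uD cD tA wt) => //.
by move=> h; rewrite h in wA.
Qed.

End PrimeDiamond.

Lemma prime_no_diamond_K1 (G : sgraph) :
  fork_free G -> prime_graph G -> connected G -> ~ has_conf G diamond_K1.
Proof.
move=> hG pG cG [[|d0 [|d1 [|d2 [|d3 [|a [|? ?]]]]]] //= uvs cvs].
have uD : uniq [:: d0; d1; d2; d3].
  exact: (@take_uniq _ [:: d0; d1; d2; d3; a] 4).
case: cvs => h01 h02 h03 h0a h12 h13 h1a h23 h2a h3a.
apply: (pendant_diamond hG pG cG uD _ (a := a)).
  by rewrite /= h01 h02 h03 h12 h13 h23.
by rewrite /anti /= ![adj a _]adj_sym h0a h1a h2a h3a.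
Qed.

(** * Claws in prime graphs *)

Definition small_confs := [:: fork_conf; coconf fork_conf; diamond_K1; coconf diamond_K1].

Definition small_table := Eval vm_compute in table small_confs.

(** With four more vertices in front, the claw has its centre at position 4 and its leaves at the
    last three; each mask marks two leaves. *)
Definition claw_pairs : seq bitseq := [seq nseq 5 false ++ m |
  m <- [:: [:: true; true; false]; [:: true; false; true]; [:: false; true; true]]].

Lemma small_exts (G : sgraph) (v : G) (vs : seq G) :
  (forall H, H \in small_confs -> ~ has_conf G H) -> uniq (v :: vs) ->
  [seq adj v u | u <- vs] \in exts small_table (conf_of vs).
Proof.
move=> hG uvs; have := exts_mem hG uvs.
have -> : table small_confs = small_table by vm_cast_no_check (erefl small_table).
by [].
Qed.

Section PrimeClaw.
Variables (G : sgraph) (hG : forall H, H \in small_confs -> ~ has_conf G H).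
Variables (pG : prime_graph G) (cG : connected G).

Let ext (v : G) (vs : seq G) : uniq (v :: vs) ->
  [seq adj v u | u <- vs] \in exts small_table (conf_of vs).
Proof. exact: small_exts. Qed.

Let pendant n : seq bool := true :: nseq n false.

Lemma pendant_row a w (F : seq G) : adj a w -> anti a F ->
  [seq adj a u | u <- w :: F] = true :: nseq (size F) false.
Proof. by move=> aw aF; rewrite /= aw anti_map. Qed.

Lemma anti_neq (F : seq G) a w : anti a F -> ~~ anti w F -> w != a.
Proof. by move=> aF; apply: contra => /eqP->. Qed.

Lemma conf_not_anti (F : seq G) H :
  conf_of F = H -> cadj H 0 1 -> exists2 c, c \in F & ~~ anti c F.
Proof.
case: F => [|c [|d F]] <- //= cd; exists c; first exact: mem_head.
by rewrite /anti /= cd orbT.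
Qed.

(** Thanks to this, the rows of [t] and [t'] in [claw_anti_unique] are fully determined and only
    those of [w] and [w'] are enumerated. *)
Lemma claw_far (F : seq G) a w b :
  uniq F -> conf_of F = claw -> anti a F -> adj a w -> ~~ anti w F ->
  anti b F -> b != a -> ~~ adj b a && ~~ adj b w.
Proof.
move=> uF cF aF aw wF bF ba; have na := anti_notin cF isT aF.
have nb := anti_notin cF isT bF; have sF : size F = 4 by rewrite -size_conf_of cF.
have nw : w \notin F.
  by apply: contra aF => wF'; apply/hasP; exists w.
have uw : uniq (w :: F) by rewrite /= nw.
have ua : uniq (a :: w :: F) by rewrite /= inE negb_or na eq_sym (anti_neq aF wF).
have ub : uniq (b :: a :: w :: F).
  by rewrite cons_uniq ua !inE !negb_or ba nb eq_sym (anti_neq bF wF).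
have chk : all (fun p => if has id p then
    if pendant 4 \in exts small_table (p :: claw) then
      all (fun q => has id (drop 2 q) || ~~ nth false q 0 && ~~ nth false q 1)
        (exts small_table (pendant 4 :: p :: claw)) else true else true)
  (exts small_table claw) by vm_compute.
have := ext uw; rewrite cF => /(allP chk); rewrite has_map (negbNE wF).
have := ext ua; rewrite (pendant_row aw aF) sF [conf_of _]/= cF => ->.
have := ext ub; rewrite [conf_of _]/= -/(map _ (w :: F)) (pendant_row aw aF) sF cF => inq /allP/(_ _ inq).
by rewrite /= drop0 has_map (negbTE bF).
Qed.

(** Two anticomplete vertices would, by connectedness, yield edges [t w] and [t' w'] with [t], [t']
    anticomplete to the claw and [w], [w'] not; for all possible rows of [w] and [w'], two leaves of
    the claw are then sealed. *)
Lemma claw_anti_unique (F : seq G) a b :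
  uniq F -> conf_of F = claw -> anti a F -> anti b F -> a = b.
Proof.
move=> uF cF aF bF; apply/eqP/negPn/negP => ab.
have sF : size F = 4 by rewrite -size_conf_of cF.
have [c cin cF'] : exists2 c, c \in F & ~~ anti c F.
  exact: conf_not_anti cF isT.
have [||t [w [tA wA tw]]] := @connected_crossing G [set x | anti x F] a c cG; rewrite ?inE //.
rewrite !inE in tA wA.
have [d dA dt] : exists2 d, anti d F & d != t.
  by case: (eqVneq a t) ab => [<-|]; [exists b; rewrite // eq_sym|exists a].
have far := claw_far uF cF.
(* Removing [t] from the set forces a second edge; its end [w'] is not [t], because [claw_far] makes
   [t] and [t'] nonadjacent. *)
have [||t' [w' [tA' wA' tw']]] := @connected_crossing G [set x | anti x F & x != t] d c cG.
- by rewrite inE dA.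
- by rewrite inE (negbTE cF').
rewrite !inE in tA' wA'; case/andP: tA' => tA' t't.
have /andP[t't_ t'w] := far t w t' tA tw wA tA' t't.
have w't_ : w' != t by apply: contraTneq tw' => ->.
have {}wA' : ~~ anti w' F by move: wA'; rewrite w't_ andbT.
have /andP[tt' tw''] : ~~ adj t t' && ~~ adj t w' by apply: far; rewrite // eq_sym.
have uw : uniq (w :: F).
  by rewrite /= uF andbT; apply: contra tA => wF'; apply/hasP; exists w.
have nt := anti_notin cF isT tA; have nt' := anti_notin cF isT tA'.
have ut : uniq (t :: w :: F) by rewrite cons_uniq uw inE negb_or nt eq_sym (anti_neq tA wA).
have uw' : uniq (w' :: t :: w :: F).
  rewrite cons_uniq ut !inE !negb_or (anti_neq tA wA') andbT /=; apply/andP; split.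
    by apply: contraTneq tw' => ->.
  by apply: contra tA' => wF'; apply/hasP; exists w'.
have ut' : uniq (t' :: w' :: t :: w :: F).
  by rewrite cons_uniq uw' !inE !negb_or t't nt' ![t' == _]eq_sym (anti_neq tA' wA) (anti_neq tA' wA').
have chk p q : p \in exts small_table claw -> has id p ->
    pendant 4 \in exts small_table (p :: claw) ->
    q \in exts small_table (pendant 4 :: p :: claw) ->
    ~~ nth false q 0 -> has id (drop 2 q) ->
    pendant 6 \in exts small_table (q :: pendant 4 :: p :: claw) ->
    has (sealed small_table (pendant 6 :: q :: pendant 4 :: p :: claw)) claw_pairs.
  have /allP h : all (fun p => if has id p then
    if pendant 4 \in exts small_table (p :: claw) then
      all (fun q => if ~~ nth false q 0 && has id (drop 2 q) then
          if pendant 6 \in exts small_table (q :: pendant 4 :: p :: claw) then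
            has (sealed small_table (pendant 6 :: q :: pendant 4 :: p :: claw)) claw_pairs
          else true else true)
        (exts small_table (pendant 4 :: p :: claw)) else true else true)
    (exts small_table claw) by vm_compute.
  move=> inp pp e1 inq q0 q2 e2; move: (h p inp); rewrite pp e1 => /allP/(_ q inq).
  by rewrite q0 q2 e2.
have rt' : [seq adj t' u | u <- w' :: t :: w :: F] = pendant 6.
  by rewrite pendant_row //= ?sF // /anti /= !negb_or t't_ t'w.
have cw : conf_of (w :: F) = [seq adj w u | u <- F] :: claw by rewrite /= cF.
have ct : conf_of (t :: w :: F) = [:: pendant 4, [seq adj w u | u <- F] & claw].
  by rewrite -cw -[pendant 4]/(true :: nseq 4 false) -sF -(pendant_row tw tA).
have cw' : conf_of (w' :: t :: w :: F) =
    [:: [seq adj w' u | u <- t :: w :: F], pendant 4, [seq adj w u | u <- F] & claw].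
  by rewrite -ct.
have ct' : conf_of (t' :: w' :: t :: w :: F) = [:: pendant 6,
    [seq adj w' u | u <- t :: w :: F], pendant 4, [seq adj w u | u <- F] & claw].
  by rewrite -cw' -rt'.
have /hasP[m _] : has (sealed small_table (conf_of (t' :: w' :: t :: w :: F))) claw_pairs.
  rewrite ct'; apply: chk.
  - by rewrite -cF; apply: ext.
  - by rewrite has_map; apply: negbNE wA.
  - by rewrite -cw -[pendant 4]/(true :: nseq 4 false) -sF -(pendant_row tw tA); apply: ext.
  - by rewrite -ct; apply: ext.
  - by rewrite /= adj_sym.
  - by rewrite /= drop0 has_map; apply: negbNE wA'.
  - by rewrite -cw' -rt'; apply: ext.
by apply/negP; apply: sealed_not_prime ext pG ut'.
Qed.

Lemma banner_dominating (F : seq G) a : uniq F -> conf_of F = banner -> ~~ anti a F.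
Proof.
move=> uF cF; apply/negP => aF; have sF : size F = 5 by rewrite -size_conf_of cF.
have [c cin cF'] : exists2 c, c \in F & ~~ anti c F.
  exact: conf_not_anti cF isT.
have [||t [w [tA wA tw]]] := @connected_crossing G [set x | anti x F] a c cG; rewrite ?inE //.
rewrite !inE in tA wA.
have uw : uniq (w :: F).
  by rewrite /= uF andbT; apply: contra tA => wF'; apply/hasP; exists w.
have nt := anti_notin cF isT tA.
have ut : uniq (t :: w :: F) by rewrite cons_uniq uw inE negb_or nt eq_sym (anti_neq tA wA).
(* After [t] and [w], positions 3 and 4 hold the two cycle neighbours of the vertex that carries the
   pendant. *)
pose m := [:: false; false; false; true; true; false; false].
have chk p : p \in exts small_table banner -> has id p ->
    pendant 5 \in exts small_table (p :: banner) ->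
    sealed small_table (pendant 5 :: p :: banner) m.
  have /allP h : all (fun p => if has id p then
      if pendant 5 \in exts small_table (p :: banner) then
        sealed small_table (pendant 5 :: p :: banner) m else true else true)
    (exts small_table banner) by vm_compute.
  by move=> inp pp e1; move: (h p inp); rewrite pp e1.
have cw : conf_of (w :: F) = [seq adj w u | u <- F] :: banner by rewrite /= cF.
have ct : conf_of (t :: w :: F) = [:: pendant 5, [seq adj w u | u <- F] & banner].
  by rewrite -cw -[pendant 5]/(true :: nseq 5 false) -sF -(pendant_row tw tA).
have : sealed small_table (conf_of (t :: w :: F)) m.
  rewrite ct; apply: chk.
  - by rewrite -cF; apply: ext.
  - by rewrite has_map; apply: negbNE wA.
  - by rewrite -cw -[pendant 5]/(true :: nseq 5 false) -sF -(pendant_row tw tA); apply: ext.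
by apply/negP; apply: sealed_not_prime ext pG ut.
Qed.

End PrimeClaw.


(** * Six-vertex exclusions and the final enumeration *)

Definition big_confs := [:: claw_2K1; claw_K2; banner_K1;
  coconf claw_2K1; coconf claw_K2; coconf banner_K1].

Lemma prime_small (G : sgraph) : fork_free G -> prime_graph G ->
  connected G -> connected (compl G) ->
  forall H, H \in small_confs -> ~ has_conf G H.
Proof.
move=> hG pG cG cG' H; rewrite !inE => /or4P[]/eqP->.
- by apply: hG; rewrite mem_head.
- by apply: hG; rewrite !inE eqxx orbT.
- exact: prime_no_diamond_K1.
move/has_conf_compl; apply: prime_no_diamond_K1 => //.
  exact: fork_free_compl.
exact: prime_graph_compl.
Qed.

Lemma small_compl (G : sgraph) :
  (forall H, H \in small_confs -> ~ has_conf G H) ->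
  forall H, H \in small_confs -> ~ has_conf (compl G) H.
Proof.
move=> hG H inH /has_conf_compl; apply: hG; move: inH; rewrite !inE.
by case/or4P=> /eqP->; rewrite ?coconfK eqxx ?orbT.
Qed.

(** The first two configurations are a claw with two anticomplete vertices, nonadjacent or adjacent;
    both contradict [claw_anti_unique]. *)
Lemma prime_half_big (G : sgraph) :
  (forall H, H \in small_confs -> ~ has_conf G H) -> prime_graph G -> connected G ->
  forall H, H \in [:: claw_2K1; claw_K2; banner_K1] -> ~ has_conf G H.
Proof.
move=> hG pG cG H inH [vs uvs cvs].
have cons6 : size vs = 6.
  by rewrite -size_conf_of cvs; move: inH; rewrite !inE => /or3P[]/eqP->.
case: vs cons6 uvs cvs => [|c0 [|c1 [|c2 [|c3 [|a [|b [|? ?]]]]]]] // _ uvs cvs.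
have uF := @take_uniq _ [:: c0; c1; c2; c3; a; b] 4 uvs.
have uB := @take_uniq _ [:: c0; c1; c2; c3; a; b] 5 uvs.
have ab : a != b by case/and5P: uvs => _ _ _ _; rewrite /= inE andbT.
have claw_anti : conf_of [:: c0; c1; c2; c3] = claw -> anti a [:: c0; c1; c2; c3] ->
    anti b [:: c0; c1; c2; c3] -> False.
  by move=> cF aF bF; move: ab; rewrite (claw_anti_unique hG pG cG uF cF aF bF) eqxx.
move: inH cvs; rewrite !inE => /or3P[]/eqP->.
- case=> h01 h02 h03 h0a h0b h12 h13 h1a h1b h23 h2a h2b h3a h3b _.
  apply: claw_anti; first by rewrite /= h01 h02 h03 h12 h13 h23.
    by rewrite /anti /= ![adj a _]adj_sym h0a h1a h2a h3a.
  by rewrite /anti /= ![adj b _]adj_sym h0b h1b h2b h3b.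
- case=> h01 h02 h03 h0a h0b h12 h13 h1a h1b h23 h2a h2b h3a h3b _.
  apply: claw_anti; first by rewrite /= h01 h02 h03 h12 h13 h23.
    by rewrite /anti /= ![adj a _]adj_sym h0a h1a h2a h3a.
  by rewrite /anti /= ![adj b _]adj_sym h0b h1b h2b h3b.
case=> h01 h02 h03 h0a h0b h12 h13 h1a h1b h23 h2a h2b h3a h3b hab.
have cB : conf_of [:: c0; c1; c2; c3; a] = banner.
  by rewrite /= h01 h02 h03 h12 h13 h23 h0a h1a h2a h3a.
have /negP[] := banner_dominating hG pG cG b uB cB.
by rewrite /anti /= ![adj b _]adj_sym h0b h1b h2b h3b hab.
Qed.

Lemma prime_big (G : sgraph) :
  (forall H, H \in small_confs -> ~ has_conf G H) -> prime_graph G ->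
  connected G -> connected (compl G) ->
  forall H, H \in big_confs -> ~ has_conf G H.
Proof.
move=> hG pG cG cG' H; rewrite -[big_confs]/([:: claw_2K1; claw_K2; banner_K1] ++
  map coconf [:: claw_2K1; claw_K2; banner_K1]) mem_cat => /orP[].
  exact: prime_half_big.
case/mapP=> K inK -> /has_conf_compl.
exact: (prime_half_big (small_compl hG) (prime_graph_compl pG) cG').
Qed.

(** The search starts from a copy of [H] and tries to complete a copy of [K], which may overlap it;
    with four vertices each, it stays within eight. *)
Lemma refute_pair (G : sgraph) (H K : conf) :
  (forall L, L \in small_confs -> ~ has_conf G L) ->
  (forall L, L \in big_confs -> ~ has_conf G L) ->
  H != [::] -> refute small_table big_confs (rev K) [::] H ->
  has_conf G H -> has_conf G K -> False.
Proof.
move=> hS hB nH ref [[|x0 vs] uvs cvs] [ws uws cws]; first by rewrite -cvs in nH.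
have cat_nil T (s : seq T) : catrev (rev s) [::] = s by rewrite catrevE cats0 revK.
have ext (v : G) us : uniq (v :: us) -> [seq adj v u | u <- us] \in exts small_table (conf_of us).
  exact: small_exts.
move: ref; rewrite -cvs.
apply: (@refuteP small_table big_confs G hB ext (rev K) [::] x0 (x0 :: vs) [::] (rev ws)) => //.
- by rewrite cat_nil.
- by rewrite !cat_nil.
- by rewrite !size_rev -cws size_conf_of.
Qed.

Lemma refute_diamond_codiamond : refute small_table big_confs (rev (coconf diamond)) [::] diamond.
Proof. vm_cast_no_check (erefl true). Qed.

Lemma refute_claw_codiamond : refute small_table big_confs (rev (coconf diamond)) [::] claw.
Proof. vm_cast_no_check (erefl true). Qed.

Lemma refute_claw_coclaw : refute small_table big_confs (rev (coconf claw)) [::] claw.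
Proof. vm_cast_no_check (erefl true). Qed.

Theorem prime_claw_or_coclaw (G : sgraph) (H K : conf) : fork_free G -> prime_graph G ->
  connected G -> connected (compl G) ->
  H \in [:: claw; diamond] -> K \in [:: claw; diamond] ->
  has_conf G H -> has_conf (compl G) K -> False.
Proof.
move=> hG pG cG cG' inH inK cH cK; have hS := prime_small hG pG cG cG'.
have hB := prime_big hS pG cG cG'; have cK' := (has_conf_compl G K).1 cK.
have hS' := small_compl hS.
have hB' : forall L, L \in big_confs -> ~ has_conf (compl G) L.
  move=> L inL /has_conf_compl; apply: hB; move: inL; rewrite !inE.
  by case/or4P=> [/eqP->|/eqP->|/eqP->|/or3P[]/eqP->]; rewrite ?coconfK eqxx ?orbT.
move: inH inK cH cK cK'; rewrite !inE => /orP[]/eqP-> /orP[]/eqP-> cH cK cK'.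
- exact: (refute_pair hS hB _ refute_claw_coclaw cH cK').
- exact: (refute_pair hS hB _ refute_claw_codiamond cH cK').
(* A diamond in [G] and a claw in the complement are the preceding case read in the complement. *)
- apply: (refute_pair hS' hB' _ refute_claw_codiamond cK) => //.
  by apply/has_conf_compl; rewrite coconfK.
- exact: (refute_pair hS hB _ refute_diamond_codiamond cH cK').
Qed.

(** * Line graphs of triangle-free graphs *)

Section LineGraphOf.
Variables (G : sgraph) (noclaw : ~ has_conf G claw) (nodia : ~ has_conf G diamond).
Implicit Types u v w a b c : G.

Let adj_neq u v : adj u v -> u != v.
Proof. by apply: contraTneq => ->; rewrite adj_irr. Qed.

Lemma claw_leaves v a b c : adj v a -> adj v b -> adj v c ->
  a != b -> a != c -> b != c -> [|| adj a b, adj a c | adj b c].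
Proof.
move=> va vb vc ab ac bc; apply/negPn/negP; rewrite !negb_or => /and3P[nab nac nbc].
apply: noclaw; exists [:: v; a; b; c]; last first.
  by rewrite /= va vb vc (negbTE nab) (negbTE nac) (negbTE nbc).
by rewrite /= !inE !negb_or ab ac bc !adj_neq.
Qed.

Lemma diamond_ends u v x y : adj u v -> adj u x -> adj v x -> adj u y -> adj v y ->
  x != y -> adj x y.
Proof.
move=> uv ux vx uy vy xy; apply/negPn/negP => nxy.
apply: nodia; exists [:: u; v; x; y]; last first.
  by rewrite /= uv ux uy vx vy (negbTE nxy).
by rewrite /= !inE !negb_or xy !adj_neq.
Qed.

(* The maximal clique containing the edge [v u]. *)
Definition edge_clique v u : {set G} := [set w | [|| w == v, w == u | adj v w && adj u w]].
Local Notation K := edge_clique.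

Lemma edge_cliqueC v u : K v u = K u v.
Proof. by apply/setP => w; rewrite !inE orbCA [adj v w && _]andbC. Qed.

Lemma edge_cliquel v u : v \in K v u. Proof. by rewrite inE eqxx. Qed.

Lemma edge_cliquer v u : u \in K v u. Proof. by rewrite inE eqxx orbT. Qed.

Lemma edge_clique_adj v u a b : adj v u -> a \in K v u -> b \in K v u -> a != b -> adj a b.
Proof.
move=> vu; rewrite !inE => /or3P[/eqP->|/eqP->|/andP[va ua]] /or3P[/eqP->|/eqP->|/andP[vb ub]] ab //.
- by rewrite eqxx in ab.
- by rewrite adj_sym.
- by rewrite eqxx in ab.
- by rewrite adj_sym.
- by rewrite adj_sym.
- exact: diamond_ends va ua vb ub ab.
Qed.

Lemma edge_clique_sub v u a b : adj v u -> a \in K v u -> b \in K v u -> K v u \subset K a b.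
Proof.
move=> vu aK bK; apply/subsetP => w wK; rewrite inE.
case: (eqVneq w a) => //= wa; case: (eqVneq w b) => //= wb.
by rewrite ![adj _ w]adj_sym !(edge_clique_adj vu).
Qed.

(** So the maximal cliques partition the edges; they will be vertices of the root graph. *)
Lemma edge_clique_eq v u a b :
  adj v u -> a \in K v u -> b \in K v u -> a != b -> K a b = K v u.
Proof.
move=> vu aK bK ab; have ab' := edge_clique_adj vu aK bK ab.
have sub := edge_clique_sub vu aK bK; apply/eqP; rewrite eqEsubset sub andbT.
by apply: edge_clique_sub; rewrite // (subsetP sub) ?edge_cliquel ?edge_cliquer.
Qed.

Definition cliques_at v : {set {set G}} := [set K v u | u in neighbours v].

Lemma cliques_atP v C : reflect (exists2 u, adj v u & C = K v u) (C \in cliques_at v).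
Proof. by apply: (iffP imsetP) => -[u h ->]; exists u; rewrite // inE in h *. Qed.

(** Neighbours of [v] taken from three different cliques would be the leaves of a claw. *)
Lemma cliques_at_card v : #|cliques_at v| <= 2.
Proof.
rewrite leqNgt; apply/negP => /card_gt2P[C1 [C2 [C3 [[+ + +] []]]]].
move=> /cliques_atP[a va ->] /cliques_atP[b vb ->] /cliques_atP[c vc ->] n12 n23 n31.
have cl x y : adj v x -> adj v y -> adj x y -> K v x = K v y.
  move=> vx vy xy; symmetry; apply: edge_clique_eq => //; rewrite ?edge_cliquel ?adj_neq //.
  by rewrite inE vy xy !orbT.
have [ab ac bc] : [/\ a != b, a != c & b != c].
  by split; [move: n12|move: n31; rewrite eq_sym|move: n23]; apply: contraNneq => ->.
case/or3P: (claw_leaves va vb vc ab ac bc) => h.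
- by rewrite (cl a b) ?eqxx in n12.
- by rewrite (cl a c) ?eqxx in n31.
- by rewrite (cl b c) ?eqxx in n23.
Qed.

(* The vertices [inr _] are pendant: they pad the ends of [v] to exactly two. *)
Definition ends v : {set {set G} + G * bool} :=
  [set inl C | C in cliques_at v] :|:
  [set inr (v, b) | b in [pred b : bool | #|cliques_at v| < (if b then 1 else 2)]].

Lemma mem_inl_ends v C : (inl C \in ends v) = (C \in cliques_at v).
Proof.
rewrite inE mem_imset; last by move=> ? ? [].
by rewrite [X in _ || X](_ : _ = false) ?orbF //; apply/negbTE/imsetP => -[].
Qed.

Lemma mem_inr_ends v p : inr p \in ends v -> p.1 = v.
Proof. by rewrite inE => /orP[/imsetP[]//|/imsetP[b _ [->]]]. Qed.

Lemma ends_card v : #|ends v| = 2.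
Proof.
rewrite cardsU card_imset; last by move=> ? ? [].
rewrite [X in _ + X - _]card_imset; last by move=> ? ? [].
rewrite [X in _ - #|pred_of_set X|](_ : _ = set0); last first.
  by apply/setP => x; rewrite !inE; apply/negP => /andP[/imsetP[C _ ->] /imsetP[]].
(* The pad [false] is present unless there are two cliques, the pad [true] only when there is
   none. *)
rewrite cards0 subn0; have := cliques_at_card v.
move: #|cliques_at v| => n le2; rewrite -sum1_card big_mkcond big_bool /= !inE.
by case: n le2 => [|[|[|]]].
Qed.

(** Each vertex of [G] becomes the edge joining its two ends; elements that are an end of no vertex
    stay isolated and do not affect the line graph. *)
Definition root_adj : rel ({set G} + G * bool) :=
  fun x y => (x != y) && [exists v, [set x; y] == ends v].

Lemma root_adj_sym : symmetric root_adj.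
Proof. by move=> x y; rewrite /root_adj eq_sym setUC. Qed.

Lemma root_adj_irr : irreflexive root_adj.
Proof. by move=> x; rewrite /root_adj eqxx. Qed.

Definition root_graph : sgraph := SGraph root_adj_sym root_adj_irr.

Lemma ends_edges (e : {set root_graph}) : (e \in edges root_graph) = [exists v, ends v == e].
Proof.
rewrite inE; apply/existsP/existsP => [[x /existsP[y]]|[v /eqP<-]].
  by case/andP=> /andP[_ /existsP[v /eqP h]] /eqP->; exists v; rewrite h.
have /eqP/cards2P[x [y [xy vE]]] := ends_card v.
exists x; apply/existsP; exists y; rewrite vE eqxx andbT /= /root_adj xy /=.
by apply/existsP; exists v; rewrite vE.
Qed.

Lemma cliques_at_common v w C :
  C \in cliques_at v -> C \in cliques_at w -> v != w -> adj v w /\ C = K v w.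
Proof.
move=> /cliques_atP[a va CE] /cliques_atP[b wb CE'] vw.
have vC : v \in C by rewrite CE edge_cliquel.
have wC : w \in C by rewrite CE' edge_cliquel.
rewrite CE in vC wC *; rewrite (edge_clique_eq va vC wC vw); split=> //.
exact: edge_clique_adj va vC wC vw.
Qed.

Lemma ends_meet v w : v != w -> (ends v :&: ends w != set0) = adj v w.
Proof.
move=> vw; apply/set0Pn/idP => [[x]|vw'].
  rewrite inE; case: x => [C|p]; last first.
    by case/andP=> /mem_inr_ends pv /mem_inr_ends pw; rewrite -pv -pw eqxx in vw.
  by rewrite !mem_inl_ends => /andP[Cv Cw]; case: (cliques_at_common Cv Cw vw).
exists (inl (K v w)); rewrite inE !mem_inl_ends; apply/andP; split.
  by apply/cliques_atP; exists w.
by apply/cliques_atP; exists v; rewrite 1?edge_cliqueC // adj_sym.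
Qed.

(** The only possible common end of distinct [v] and [w] is the clique [K v w], whereas [v] has two
    ends. *)
Lemma ends_inj : injective ends.
Proof.
move=> v w E; apply/eqP/negPn/negP => vw.
have /eqP/cards2P[x [y [xy vE]]] := ends_card v.
have inb z : z \in ends v -> exists2 C, z = inl C & C = K v w.
  case: z => [C|p] zv; have zw := zv; rewrite E in zw; last first.
    by rewrite -(mem_inr_ends zv) -(mem_inr_ends zw) eqxx in vw.
  by exists C => //; rewrite !mem_inl_ends in zv zw; case: (cliques_at_common zv zw vw).
have [|C xC CE] := inb x; first by rewrite vE !inE eqxx.
have [|C' yC' CE'] := inb y; first by rewrite vE !inE eqxx orbT.
by rewrite xC yC' CE CE' eqxx in xy.
Qed.

(** The sides of a triangle come from pairwise adjacent vertices [a], [b], [c]; these lie in one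
    maximal clique, so two corners coincide. *)
Lemma root_triangle_free : triangle_free root_graph.
Proof.
move=> x y z; apply/negP => /and3P[/andP[xy /existsP[a /eqP aE]]].
case/andP=> yz /existsP[b /eqP bE] /andP[xz /existsP[c /eqP cE]].
have [xa ya] : x \in ends a /\ y \in ends a by rewrite -aE !inE !eqxx orbT.
have [yb zb] : y \in ends b /\ z \in ends b by rewrite -bE !inE !eqxx orbT.
have [xc zc] : x \in ends c /\ z \in ends c by rewrite -cE !inE !eqxx orbT.
have ab : a != b.
  by apply: contraNneq xy => E; move: xa; rewrite E -bE !inE (negbTE xz) orbF.
have ac : a != c.
  by apply: contraNneq yz => E; move: ya; rewrite E -cE !inE eq_sym (negbTE xy).
have bc : b != c.
  by apply: contraNneq xy => E; move: yb; rewrite E -cE !inE (negbTE yz) orbF eq_sym.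
have common u v p : u != v -> p \in ends u -> p \in ends v -> adj u v /\ p = inl (K u v).
  move=> uv; case: p => [C|p]; last by move=> /mem_inr_ends pu /mem_inr_ends pv; rewrite -pu -pv eqxx in uv.
  by rewrite !mem_inl_ends => pu pv; case: (cliques_at_common pu pv uv) => -> ->.
have [ac' xE] := common _ _ _ ac xa xc; have [ab' yE] := common _ _ _ ab ya yb.
have [bc' _] := common _ _ _ bc zb zc.
case/eqP: xy; rewrite xE yE; congr inl; symmetry; apply: edge_clique_eq => //.
  exact: edge_cliquel.
by rewrite inE ab' [adj c b]adj_sym bc' !orbT.
Qed.

Theorem line_graph_of_claw_diamond_free : is_line_graph_of_triangle_free G.
Proof.
exists root_graph; first exact: root_triangle_free.
have memE v : ends v \in edges root_graph by rewrite ends_edges; apply/existsP; exists v.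
have exE (e : {e : {set root_graph} | e \in edges root_graph}) : exists v, ends v == val e.
  by apply/existsP; rewrite -ends_edges; apply: valP.
exists (fun v => exist (fun e => e \in edges root_graph) _ (memE v)).
  exists (fun e => xchoose (exE e)) => [v|e].
    by apply: ends_inj; apply/eqP; exact: (xchooseP (exE _)).
  by apply: val_inj; apply/eqP; apply: (xchooseP (exE e)).
move=> v w; rewrite /= /line_adj -val_eqE /=.
case: (eqVneq v w) => [->|vw]; first by rewrite eqxx adj_irr.
by rewrite ends_meet // (inj_eq ends_inj) vw.
Qed.

End LineGraphOf.

(** * Candelabra from blown-up paths *)

Section Candled.
Variables (G : sgraph) (Y Z : {set G}).
Hypotheses (Y0 : Y != set0) (YZ : [disjoint Y & Z]).
Hypothesis hY : {in Y, forall y, exists2 z, z \in Z & adj y z}.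
Hypothesis hZ : {in Z, forall z, exists2 y, y \in Y & adj y z}.
Hypothesis hZZ : forall y z z', y \in Y -> z \in Z -> z' \in Z -> z != z' ->
  adj y z -> adj y z' = ~~ adj z z'.
Hypothesis hYY : forall z y y', z \in Z -> y \in Y -> y' \in Y -> y != y' ->
  adj y z -> adj y' z = adj y y'.
Hypothesis hZR : forall z r, z \in Z -> r \notin Y -> r \notin Z -> adj z r.
Hypothesis hYR : forall y r, y \in Y -> r \notin Y -> r \notin Z -> ~~ adj y r.

Let S := Y :|: Z.
Let N y : {set G} := [set z in Z | adj y z].
(** The parts are recovered from adjacency: [hZZ] makes the neighbours in [Z] of a vertex of [Y] a
    class of the nonadjacency relation on [Z], and [hYY] makes two such sets equal or disjoint. Each
    of these sets is one [Z_i]; the vertices of [Y] having it as neighbourhood in [Z] form [Y_i]. *)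
Let classes : {set {set G}} := [set N y | y in Y].
Let Zc (i : 'I_#|classes|) : {set G} := enum_val i.
Let Yc (i : 'I_#|classes|) : {set G} := [set y in Y | N y == Zc i].
Let pre (A : {set G}) : {set induced S} := [set x | val x \in A].

Let preE A x : (x \in pre A) = (val x \in A). Proof. by rewrite inE. Qed.

Let inj_S y (yS : y \in S) : induced S := exist (fun x => x \in S) y yS.

Let N_meet y y' z : y \in Y -> y' \in Y -> z \in N y -> z \in N y' -> N y = N y'.
Proof.
move=> yY y'Y; rewrite !inE => /andP[zZ yz] /andP[_ y'z].
case: (eqVneq y y') => [-> //|yy']; have ad := hYY zZ yY y'Y yy' yz.
rewrite y'z in ad; apply/setP => x; rewrite !inE; case: (boolP (x \in Z)) => //= xZ.
apply/idP/idP => h; first by rewrite (hYY xZ yY y'Y).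
by rewrite (hYY xZ y'Y yY) 1?eq_sym // adj_sym.
Qed.

Let ZcP i : exists2 y, y \in Y & Zc i = N y.
Proof. by have /imsetP[y yY E] := enum_valP i; exists y. Qed.

Let Zc_sub i z : z \in Zc i -> z \in Z.
Proof. by have [y _ ->] := ZcP i; rewrite inE => /andP[]. Qed.

Let Zc_inj i j z : z \in Zc i -> z \in Zc j -> i = j.
Proof.
have [y yY Ey] := ZcP i; have [y' y'Y Ey'] := ZcP j; rewrite Ey Ey' => h h'.
by apply: enum_val_inj; rewrite -/(Zc i) -/(Zc j) Ey Ey'; apply: N_meet h h'.
Qed.

Let Yc_adj i y z : y \in Yc i -> z \in Z -> adj y z = (z \in Zc i).
Proof. by rewrite inE => /andP[yY /eqP<-] zZ; rewrite inE zZ. Qed.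

Let Yc_sub i y : y \in Yc i -> y \in Y.
Proof. by rewrite inE => /andP[]. Qed.

Let parts : candelabrum_parts (fun i => pre (Yc i)) (fun i => pre (Zc i)).
Proof.
have YS y : y \in Y -> y \in S by move=> yY; rewrite inE yY.
have ZS z : z \in Z -> z \in S by move=> zZ; rewrite inE zZ orbT.
have neYZ y z : y \in Y -> z \in Z -> y != z.
  by move=> yY zZ; apply: contraTneq yY => ->; rewrite (disjointFl YZ).
split.
- split=> i; have [y yY Ey] := ZcP i; apply/set0Pn.
    by exists (inj_S (YS y yY)); rewrite !inE /= yY Ey eqxx.
  have [z zZ yz] := hY yY; exists (inj_S (ZS z zZ)).
  by rewrite inE /= Ey inE zZ.
- split=> i j => [ij|ij|]; rewrite -setI_eq0; apply/eqP/setP => x; rewrite !inE.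
  + by apply: contraNF ij => /andP[/andP[_ /eqP->] /andP[_ /eqP/enum_val_inj->]].
  + by apply: contraNF ij => /andP[xi /(Zc_inj xi)->].
  + by apply/negP => /andP[/andP[xY _] /Zc_sub xZ]; case/eqP: (neYZ _ _ xY xZ).
- apply/setP => -[x xS]; rewrite [RHS]inE; apply/setUP.
  have /setUP[xY|xZ] := xS; [left|right]; apply/bigcupP.
    have NC : N x \in classes by apply/imsetP; exists x.
    by exists (enum_rank_in NC (N x)) => //; rewrite inE /= inE xY /Zc /= enum_rankK_in.
  have [y yY yx] := hZ xZ; have NC : N y \in classes by apply/imsetP; exists y.
  by exists (enum_rank_in NC (N y)) => //; rewrite inE /= /Zc /= enum_rankK_in // inE xZ.
- split=> i x x'; rewrite !preE -?val_eqE => xi' x'i'.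
    have [y0 y0Y Ey] := ZcP i; have [z zZ y0z] := hY y0Y.
    have zi : z \in Zc i by rewrite Ey inE zZ.
    move=> xx'; rewrite /= /induced_adj -(hYY zZ (Yc_sub xi') (Yc_sub x'i') xx').
      by rewrite (Yc_adj x'i').
    by rewrite (Yc_adj xi').
  have [y yY Ey] := ZcP i; rewrite /= /induced_adj.
  case: (eqVneq (val x) (val x')) => [->|xx']; first by rewrite adj_irr.
  move: (xi') (x'i'); rewrite Ey !inE => /andP[xZ yx] /andP[x'Z yx'].
  by rewrite -(hZZ yY xZ x'Z xx' yx).
have main i j y y' : i != j -> y \in Yc i -> y' \in Yc j -> ~~ adj y y'.
  move=> ij yi y'j; have [z zZ yz] := hY (Yc_sub yi).
  have zi : z \in Zc i by rewrite -(Yc_adj yi).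
  case: (eqVneq y y') => [->|yy']; first by rewrite adj_irr.
  rewrite -(hYY zZ (Yc_sub yi) (Yc_sub y'j) yy' yz) (Yc_adj y'j zZ).
  by apply: contra ij => zj; apply/eqP; apply: Zc_inj zi zj.
split=> [i j ij y y'|i j ij z z'|i y z|i j ij y z]; rewrite !preE /= /induced_adj.
- by apply: main; rewrite neq_ltn ij.
- move=> zi z'j; have [y yY Ey] := ZcP i.
  have zz' : val z != val z'.
    apply: contraTneq ij => E; rewrite E in zi; by rewrite (Zc_inj zi z'j) ltnn.
  move: (zi); rewrite {1}Ey inE => /andP[zZ yz].
  apply/negPn; rewrite -(hZZ yY zZ (Zc_sub z'j) zz' yz); apply/negP => yz'.
  have z'i : val z' \in Zc i by rewrite Ey inE (Zc_sub z'j).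
  by rewrite (Zc_inj z'i z'j) ltnn in ij.
- by move=> yi zi; rewrite (Yc_adj yi) ?(Zc_sub zi).
- move=> yi zj; rewrite (Yc_adj yi (Zc_sub zj)); apply: contra ij => zi.
  by apply/eqP; apply: Zc_inj zi zj.
Qed.

Lemma candled_of : candled G.
Proof.
exists S, (pre Z); split.
- exists #|classes|, (fun i => pre (Yc i)), (fun i => pre (Zc i)); split=> //.
    have /set0Pn[y yY] := Y0; apply/card_gt0P; exists (N y).
    by apply/imsetP; exists y.
  apply/setP => x; apply/idP/bigcupP => [|[i _]]; rewrite !inE; last exact: Zc_sub.
  move=> xZ; have [y yY yx] := hZ xZ; have NC : N y \in classes by apply/imsetP; exists y.
  by exists (enum_rank_in NC (N y)) => //; rewrite inE /= /Zc /= enum_rankK_in // inE xZ.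
- move=> _ r /imsetP[z zZ ->]; rewrite !inE negb_or => /andP[rY rZ].
  by apply: hZR; rewrite // inE in zZ.
move=> _ r /imsetP[y yZ ->]; rewrite !inE negb_or => /andP[rY rZ].
apply: hYR => //; have := valP y; rewrite !inE in yZ *.
by rewrite (negbTE yZ) orbF.
Qed.

End Candled.

(* Types of vertices relative to a path [p1 p2 p3 p4], whose own vertices have
   types [Y0], [Z0], [Z1], [Y1].  In use, the default case of [type_of_row] is
   the row of a vertex adjacent to exactly [p2] and [p3]. *)
Inductive vtype := Y0 | Z0 | Z1 | Y1 | Out | All | Mid.

Definition type_of_row (r : seq bool) : vtype :=
  match r with
  | [:: true; true; false; false] | [:: false; true; false; false] => Y0
  | [:: true; false; true; false] => Z0
  | [:: false; true; false; true] => Z1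
  | [:: false; false; true; true] | [:: false; false; true; false] => Y1
  | [:: false; false; false; false] => Out
  | [:: true; true; true; true] => All
  | _ => Mid
  end.

(** Among the four types of the path these are the adjacencies of a candelabrum with two pairs of
    parts; [None] marks pairs left undetermined. *)
Definition type_adj (s t : vtype) : option bool :=
  match s, t with
  | Y0, Y0 | Y1, Y1 | Y0, Z0 | Z0, Y0 | Y1, Z1 | Z1, Y1 | Z0, Z1 | Z1, Z0 => Some true
  | Y0, Y1 | Y1, Y0 | Z0, Z0 | Z1, Z1 | Y0, Z1 | Z1, Y0 | Y1, Z0 | Z0, Y1 => Some false
  | (Y0 | Y1 | Z0 | Z1), Out | Out, (Y0 | Y1 | Z0 | Z1) => Some false
  | (Y0 | Y1 | Z0 | Z1), All | All, (Y0 | Y1 | Z0 | Z1) => Some true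
  | (Y0 | Y1), Mid | Mid, (Y0 | Y1) => Some false
  | (Z0 | Z1), Mid | Mid, (Z0 | Z1) => Some true
  | _, _ => None
  end.

Definition agrees (o : option bool) (b : bool) : bool := if o is Some c then b == c else true.

(* In the complement the path becomes [p2 p4 p1 p3]. *)
Definition co_type (t : vtype) : vtype :=
  match t with
  | Y0 => Z1 | Z0 => Y0 | Z1 => Y1 | Y1 => Z0 | Out => All | All => Out | Mid => Mid
  end.

Lemma agrees_co s t b :
  agrees (type_adj s t) b -> agrees (type_adj (co_type s) (co_type t)) (~~ b).
Proof. by case: s; case: t; case: b. Qed.

(** The conditions [bl_out] and [bl_all] are exchanged by complementation. *)
Record blowup (G : sgraph) (k : G -> vtype) (p1 p2 p3 p4 : G) : Prop := Blowup {
  bl1 : k p1 = Y0; bl2 : k p2 = Z0; bl3 : k p3 = Z1; bl4 : k p4 = Y1;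
  bl_adj : forall v w, v != w -> agrees (type_adj (k v) (k w)) (adj v w);
  bl_out : forall o o' r, k o = Out -> k o' = Out -> k r = Mid ->
    adj o o' -> adj r o -> adj r o';
  bl_all : forall a a' r, k a = All -> k a' = All -> k r = Mid -> a != a' ->
    ~~ adj a a' -> ~~ adj r a -> ~~ adj r a' }.

Lemma blowup_compl (G : sgraph) (k : G -> vtype) p1 p2 p3 p4 :
  blowup k p1 p2 p3 p4 -> @blowup (compl G) (co_type \o k) p2 p4 p1 p3.
Proof.
case=> k1 k2 k3 k4 kadj kout kall.
have co t : co_type t = Out -> t = All by case: t.
have co' t : co_type t = All -> t = Out by case: t.
have co'' t : co_type t = Mid -> t = Mid by case: t.
have ne v w t t' : k v = t -> k w = t' -> t <> t' -> v != w.
  by move=> <- <- tt'; apply/eqP => E; rewrite E in tt'.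
split; rewrite /= ?k1 ?k2 ?k3 ?k4 //.
- by move=> v w vw; rewrite /= /compl_adj vw; apply/agrees_co/kadj.
- move=> a a' r /co ka /co ka' /co'' kr; rewrite /= /compl_adj => /andP[aa' naa'].
  by rewrite !(ne r _ Mid All) //=; apply: kall.
move=> o o' r /co' ko /co' ko' /co'' kr oo'; rewrite /= /compl_adj oo' /=.
by rewrite !(ne r _ Mid Out) //= !negbK; apply: kout.
Qed.

Lemma cons3_uniq (T : eqType) (x y z : T) s : uniq s -> x \notin s -> y \notin s ->
  z \notin s -> x != y -> x != z -> y != z -> uniq [:: z, y, x & s].
Proof.
move=> us xs ys zs xy xz yz; rewrite /= us !inE !negb_or.
by rewrite ![_ == x]eq_sym [z == y]eq_sym xs ys zs xy xz yz.
Qed.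

Section Blowup.
Variables (G : sgraph) (hG : fork_free G) (k : G -> vtype) (p1 p2 p3 p4 : G).
Hypothesis kG : blowup k p1 p2 p3 p4.

Let k_neq v w t t' : k v = t -> k w = t' -> t <> t' -> v != w.
Proof. by move=> <- <- tt'; apply/eqP => E; rewrite E in tt'. Qed.

Let k_adj v w s t b : k v = s -> k w = t -> v != w -> type_adj s t = Some b -> adj v w = b.
Proof. by move=> <- <- vw E; have := bl_adj kG vw; rewrite E => /eqP. Qed.

Let path := [:: p1; p2; p3; p4].

Definition path_conf := conf_on 4 [:: (0, 1); (1, 2); (2, 3)].

Definition type_row (t : vtype) : seq bool :=
  match t with
  | Out => nseq 4 false | All => nseq 4 true | _ => [:: false; true; true; false]
  end.

Let free t := if t is (Out | All | Mid) then true else false.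

Let path_row v t : k v = t -> free t -> [seq adj v u | u <- path] = type_row t.
Proof.
case: kG => k1 k2 k3 k4 _ _ _ kv ft.
have e p s b : k p = s -> ~~ free s -> type_adj t s = Some b -> adj v p = b.
  move=> kp fs; apply: (k_adj kv kp); apply: (k_neq kv kp) => E.
  by rewrite -E ft in fs.
by case: t kv ft e => // _ _ e; rewrite /= (e _ _ _ k1 isT erefl) (e _ _ _ k2 isT erefl)
  (e _ _ _ k3 isT erefl) (e _ _ _ k4 isT erefl).
Qed.

Let path_confE : conf_of path = path_conf.
Proof.
case: kG => k1 k2 k3 k4 _ _ _.
have e p q s t b : k p = s -> k q = t -> s <> t -> type_adj s t = Some b -> adj p q = b.
  by move=> kp kq st; apply: (k_adj kp kq); apply: k_neq kp kq st.
by rewrite /= (e _ _ _ _ _ k1 k2 _ erefl) // (e _ _ _ _ _ k1 k3 _ erefl) //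
  (e _ _ _ _ _ k1 k4 _ erefl) // (e _ _ _ _ _ k2 k3 _ erefl) //
  (e _ _ _ _ _ k2 k4 _ erefl) // (e _ _ _ _ _ k3 k4 _ erefl).
Qed.

Let path_uniq : uniq path.
Proof.
case: kG => k1 k2 k3 k4 _ _ _; rewrite /= !inE !negb_or.
by rewrite (k_neq k1 k2) // (k_neq k1 k3) // (k_neq k1 k4) // (k_neq k2 k3) //
  (k_neq k2 k4) // (k_neq k3 k4).
Qed.

Let free_notin v t : k v = t -> free t -> v \notin path.
Proof.
case: kG => k1 k2 k3 k4 _ _ _ kv ft; rewrite !inE !negb_or; apply/and4P; split;
  by apply: (k_neq kv); first eassumption; move=> E; rewrite E in ft.
Qed.

(** With three vertices of free types all rows to the path are known, so only their three mutual
    adjacencies, eight cases, remain to be tested. *)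
Definition triple_ok (s t u : vtype) (yx zx zy : bool) : bool :=
  [:: zy, zx & type_row u] \in exts fork_table ((yx :: type_row t) :: type_row s :: path_conf).

Let triple x y z s t u : k x = s -> k y = t -> k z = u -> free s -> free t -> free u ->
  x != y -> x != z -> y != z -> triple_ok s t u (adj y x) (adj z x) (adj z y).
Proof.
move=> kx ky kz fs ft fu xy xz yz.
have nx := free_notin kx fs; have ny := free_notin ky ft; have nz := free_notin kz fu.
have uall : uniq (z :: y :: x :: path).
  exact: cons3_uniq.
have row2 (s' : seq G) : [seq adj z v | v <- [:: y, x & s']] =
  [:: adj z y, adj z x & [seq adj z v | v <- s']] by [].
have conf2 (s' : seq G) : conf_of [:: y, x & s'] =
  [:: adj y x :: [seq adj y v | v <- s'], [seq adj x v | v <- s'] & conf_of s'] by [].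
have := fork_exts hG uall; rewrite (row2 path) (conf2 path) path_confE.
by rewrite (path_row kx fs) (path_row ky ft) (path_row kz fu).
Qed.

Lemma out_all_mid o a r : k o = Out -> k a = All -> k r = Mid ->
  (adj o r -> adj a o) /\ (adj a o -> adj r a).
Proof.
move=> ko ka kr; have := triple ko ka kr isT isT isT.
rewrite (k_neq ko ka) // (k_neq ko kr) // (k_neq ka kr) // => /(_ isT isT isT).
have chk yx zx zy : triple_ok Out All Mid yx zx zy -> (zx ==> yx) && (yx ==> zy).
  by case: yx; case: zx; case: zy; vm_compute.
by rewrite [adj o r]adj_sym => /chk/andP[/implyP ? /implyP ?].
Qed.

Lemma out_mid_mid o r r' : k o = Out -> k r = Mid -> k r' = Mid -> r != r' ->
  adj o r -> adj o r' = ~~ adj r r'.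
Proof.
move=> ko kr kr' rr'; have := triple ko kr kr' isT isT isT.
rewrite (k_neq ko kr) // (k_neq ko kr') // rr' => /(_ isT isT isT).
have chk yx zx zy : triple_ok Out Mid Mid yx zx zy -> yx ==> (zx == ~~ zy).
  by case: yx; case: zx; case: zy; vm_compute.
by rewrite ![adj o _]adj_sym [adj r r']adj_sym => /chk/implyP h /h/eqP.
Qed.

Lemma out_out_mid o o' r : k o = Out -> k o' = Out -> k r = Mid -> o != o' ->
  adj o r -> adj o' r = adj o o'.
Proof.
move=> ko ko' kr oo' or; have := triple ko ko' kr isT isT isT.
rewrite (k_neq ko kr) // (k_neq ko' kr) // oo' => /(_ isT isT isT).
have chk yx zx zy : triple_ok Out Out Mid yx zx zy -> zx && zy ==> yx.
  by case: yx; case: zx; case: zy; vm_compute.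
rewrite ![adj r _]adj_sym or [adj o' o]adj_sym => /chk/implyP h; apply/idP/idP=> //.
by move=> oo; rewrite adj_sym; apply: (bl_out kG ko ko' kr oo); rewrite adj_sym.
Qed.

(** An adjacent pair of an [Out] and a [Mid] vertex enters a further pair of parts [Y_i], [Z_i],
    beyond the two given by the path. *)
Let isY v := match k v with
  | Y0 | Y1 => true
  | Out => [exists r, (if k r is Mid then adj v r else false)]
  | _ => false end.
Let isZ v := match k v with
  | Z0 | Z1 => true
  | Mid => [exists o, (if k o is Out then adj o v else false)]
  | _ => false end.

Let isY_out o r : k o = Out -> k r = Mid -> adj o r -> isY o.
Proof. by move=> ko kr or; rewrite /isY ko; apply/existsP; exists r; rewrite kr. Qed.

Let isZ_mid o r : k o = Out -> k r = Mid -> adj o r -> isZ r.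
Proof. by move=> ko kr or; rewrite /isZ kr; apply/existsP; exists o; rewrite ko. Qed.

Let isY_cases v : isY v -> [\/ k v = Y0, k v = Y1 | k v = Out /\ exists2 r, k r = Mid & adj v r].
Proof.
rewrite /isY; case kv: (k v) => // h; [by constructor 1|by constructor 2|].
constructor 3; split=> //; move/existsP: h => [r]; case kr: (k r) => // vr.
by exists r.
Qed.

Let isZ_cases v : isZ v -> [\/ k v = Z0, k v = Z1 | k v = Mid /\ exists2 o, k o = Out & adj o v].
Proof.
rewrite /isZ; case kv: (k v) => // h; [by constructor 1|by constructor 2|].
constructor 3; split=> //; move/existsP: h => [o]; case ko: (k o) => // ov.
by exists o.
Qed.

Ltac neq_types := solve [assumption | by rewrite eq_sym | eapply k_neq; [eassumption|eassumption|discriminate]].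
Ltac adj_by_type := repeat match goal with
  | kv : k ?v = ?s, kw : k ?w = ?t |- context [adj ?v ?w] =>
    let o := eval compute in (type_adj s t) in
    match o with Some ?b => rewrite (@k_adj v w s t b kv kw); [|neq_types|reflexivity] end
  end.

Let Y : {set G} := [set v | isY v].
Let Z : {set G} := [set v | isZ v].
Let rest : {set G} := [set v | match k v with All => true | Out => ~~ isY v | _ => false end].

Hypothesis all_mid : forall a r, k a = All -> k r = Mid -> adj a r.

(** With [rest] empty, the vertices outside [Y] and [Z] are [Mid] vertices without [Out] neighbour.
    Against a [Mid] vertex of [Z], [out_mid_mid] gives adjacency; the other pairs follow from the
    types. *)
Let candled_rest : rest = set0 -> candled G.
Proof.
move=> rest0; have [k1 k2 k3 k4 _ _ _] := kG.
have YE v : (v \in Y) = isY v by rewrite inE.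
have ZE v : (v \in Z) = isZ v by rewrite inE.
have Z0E v : k v = Z0 -> isZ v by rewrite /isZ => ->.
have Z1E v : k v = Z1 -> isZ v by rewrite /isZ => ->.
have Y0E v : k v = Y0 -> isY v by rewrite /isY => ->.
have Y1E v : k v = Y1 -> isY v by rewrite /isY => ->.
have other r : ~~ isY r -> ~~ isZ r -> k r = Mid.
  move=> nY nZ; have : r \notin rest by rewrite rest0 inE.
  by rewrite inE; move: nY nZ; rewrite /isY /isZ; case: (k r) => //= ->.
apply: (@candled_of G Y Z).
- by apply/set0Pn; exists p1; rewrite YE Y0E.
- rewrite -setI_eq0; apply/eqP/setP => v; rewrite !inE /isY /isZ.
  by case: (k v); rewrite ?andbF.
- move=> y; rewrite YE => /isY_cases[ky|ky|[ky [r kr yr]]].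
  + by exists p2; rewrite ?ZE ?Z0E //; adj_by_type.
  + by exists p3; rewrite ?ZE ?Z1E //; adj_by_type.
  + by exists r; rewrite ?ZE ?(isZ_mid ky kr).
- move=> z; rewrite ZE => /isZ_cases[kz|kz|[kz [o ko oz]]].
  + by exists p1; rewrite ?YE ?Y0E //; adj_by_type.
  + by exists p4; rewrite ?YE ?Y1E //; adj_by_type.
  + by exists o; rewrite ?YE ?(isY_out ko kz).
- move=> y z z'; rewrite YE !ZE => /isY_cases yc /isZ_cases zc /isZ_cases zc' zz'.
  case: yc => [ky|ky|[ky _]]; case: zc => [kz|kz|[kz _]]; adj_by_type => // yz;
    case: zc' => [kz'|kz'|[kz' _]]; adj_by_type => //.
  exact: out_mid_mid.
- move=> z y y'; rewrite ZE !YE => /isZ_cases zc /isY_cases yc /isY_cases yc' yy'.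
  case: zc => [kz|kz|[kz _]]; case: yc => [ky|ky|[ky _]]; adj_by_type => // yz;
    case: yc' => [ky'|ky'|[ky' _]]; adj_by_type => //.
  exact: out_out_mid.
- move=> z r; rewrite ZE YE => /isZ_cases zc nY; rewrite ZE => nZ; have kr := other r nY nZ.
  case: zc => [kz|kz|[kz [o ko oz]]]; adj_by_type => //.
  have zr : z != r by apply: contraNneq nZ => <-; apply: isZ_mid oz.
  have E := out_mid_mid ko kz kr zr oz; apply/negPn/negP => nzr.
  by case/negP: nZ; apply: (isZ_mid ko kr); rewrite E.
move=> y r; rewrite YE => /isY_cases yc; rewrite YE ZE => nY nZ; have kr := other r nY nZ.
case: yc => [ky|ky|[ky _]]; adj_by_type => //.
by apply: contra nZ; apply: isZ_mid.
Qed.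

(** Vertices of type [All] are complete to the complement of [rest]; [Out] vertices without [Mid]
    neighbour are anticomplete to it, by [bl_out]. *)
Let module_rest : is_module (~: rest).
Proof.
apply/moduleP => v x y; rewrite in_setC negbK => vr xr yr.
suff [b h] : exists b, forall u, u \in ~: rest -> adj v u = b by rewrite !h.
have cases u : u \in ~: rest -> [\/ k u = Y0, k u = Z0 | [\/ k u = Z1, k u = Y1 |
    k u = Mid \/ k u = Out /\ exists2 r, k r = Mid & adj u r]].
  rewrite !inE; case ku: (k u) => //= h; [by constructor 1|by constructor 2|..]; constructor 3.
  - by constructor 1.
  - by constructor 2.
  - by constructor 3; right; have [E|E|[_ E]] := isY_cases (negbNE h); rewrite ?ku // in E *.
  - by constructor 3; left.
move: vr; rewrite inE; case kv: (k v) => // nY.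
  exists false => u /cases[ku|ku|[ku|ku|[ku|[ku [r kr ur]]]]]; adj_by_type => //.
    by apply: contraNF nY; apply: isY_out.
  apply: contraNF nY => vu; apply: (isY_out kv kr); rewrite adj_sym.
  by apply: (bl_out kG ku kv kr); rewrite adj_sym.
exists true => u /cases[ku|ku|[ku|ku|[ku|[ku [r kr ur]]]]]; adj_by_type => //.
  exact: all_mid.
by case: (out_all_mid ku kv kr) => h _; apply: h.
Qed.

Lemma candled_or_module : candled G \/ exists V : {set G},
  [/\ is_module V, V != [set: G] & forall v, k v <> Out -> k v <> All -> v \in V].
Proof.
case: (set_0Vmem rest) => [/candled_rest|[x xr]]; [by left|right].
exists (~: rest); split; first exact: module_rest.
  by apply/negP => /eqP E; have := in_setT x; rewrite -E in_setC xr.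
by move=> v; rewrite !inE; case: (k v).
Qed.

End Blowup.

(** If some [All] vertex misses a [Mid] vertex, the two implications of [out_all_mid] exclude every
    edge between [Out] and [Mid], which is the hypothesis [all_mid] in the complement. *)
Lemma blowup_candled (G : sgraph) (k : G -> vtype) (p1 p2 p3 p4 : G) :
  fork_free G -> blowup k p1 p2 p3 p4 -> candled G \/ candled (compl G) \/
  exists V : {set G}, [/\ is_module V, V != [set: G] &
    forall v, k v <> Out -> k v <> All -> v \in V].
Proof.
move=> hG kG.
case: (boolP [forall a, forall r,
    match k a, k r with All, Mid => adj a r | _, _ => true end]) => [/forallP nc|].
  case: (candled_or_module hG kG) => [a r ka kr||h]; [|by left|by right; right].
  by have /forallP/(_ r) := nc a; rewrite ka kr.
case/forallPn => a /forallPn[r]; case ka: (k a) => //; case kr: (k r) => // ar.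
case: (candled_or_module (fork_free_compl hG) (blowup_compl kG)) => [o r'||[V [mV VT kV]]].
- rewrite /=; case ko: (k o) => // _; case kr': (k r') => // _.
  rewrite /compl_adj; apply/andP; split; first by apply/eqP => E; rewrite E kr' in ko.
  apply/negP => or'; have [oa ra] := out_all_mid hG kG ko ka kr.
  have [oa' _] := out_all_mid hG kG ko ka kr'.
  by case/negP: ar; rewrite adj_sym; apply/ra/oa'.
- by right; left.
right; right; exists V; rewrite is_module_compl in mV; split=> // v kO kA.
by apply: kV => /=; move: kO kA; case: (k v).
Qed.

(** Adjacent twins of the path's ends, nonadjacent twins of its inner vertices, and the three free
    types. *)
Definition outer_rows : seq (seq bool) :=
  [:: [:: true; true; false; false]; [:: false; false; true; true];
      [:: true; false; true; false]; [:: false; true; false; true];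
      nseq 4 false; nseq 4 true; [:: false; true; true; false]].

Definition vertex_type (G : sgraph) (p1 p2 p3 p4 v : G) : vtype :=
  type_of_row [seq adj v p | p <- [:: p1; p2; p3; p4]].

Lemma outer_rows_agree b1 b2 b3 b4 : let t := type_of_row [:: b1; b2; b3; b4] in
  [:: b1; b2; b3; b4] \in outer_rows ->
  [&& agrees (type_adj Y0 t) b1, agrees (type_adj Z0 t) b2,
      agrees (type_adj Z1 t) b3 & agrees (type_adj Y1 t) b4].
Proof. by case: b1; case: b2; case: b3; case: b4. Qed.

Lemma blowup_of_rows (G : sgraph) (p1 p2 p3 p4 : G) :
  let path := [:: p1; p2; p3; p4] in
  let k := vertex_type p1 p2 p3 p4 in
  conf_of path = path_conf ->
  (forall v, v \notin path -> [seq adj v p | p <- path] \in outer_rows) ->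
  (forall v w, v \notin path -> w \notin path -> v != w ->
     agrees (type_adj (k v) (k w)) (adj v w)) ->
  (forall o o' r, k o = Out -> k o' = Out -> k r = Mid ->
     adj o o' -> adj r o -> adj r o') ->
  (forall a a' r, k a = All -> k a' = All -> k r = Mid -> a != a' ->
     ~~ adj a a' -> ~~ adj r a -> ~~ adj r a') ->
  blowup k p1 p2 p3 p4.
Proof.
move=> path k; rewrite /path => -[h12 h13 h14 h23 h24 h34] rows adjo hout hall.
have k1 : k p1 = Y0 by rewrite /k /vertex_type /= adj_irr h12 h13 h14.
have k2 : k p2 = Z0 by rewrite /k /vertex_type /= adj_irr ![adj p2 _]adj_sym h12 [adj p3 _]adj_sym h23 [adj p4 _]adj_sym h24.
have k3 : k p3 = Z1 by rewrite /k /vertex_type /= adj_irr [adj p3 p1]adj_sym [adj p3 p2]adj_sym h13 h23 h34.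
have k4 : k p4 = Y1 by rewrite /k /vertex_type /= adj_irr ![adj p4 _]adj_sym h14 h24 h34.
have inout v w : v \in path -> w \notin path -> agrees (type_adj (k v) (k w)) (adj v w).
  move=> vP /rows/outer_rows_agree/and4P[c1 c2 c3 c4]; rewrite adj_sym.
  by move: vP; rewrite !inE => /or4P[]/eqP->; rewrite ?k1 ?k2 ?k3 ?k4.
split=> // v w vw; case: (boolP (v \in path)) => vP; case: (boolP (w \in path)) => wP.
- move: vP wP vw; rewrite !inE => /or4P[]/eqP-> /or4P[]/eqP->; rewrite ?eqxx // => _;
    rewrite ?k1 ?k2 ?k3 ?k4 ?h12 ?h13 ?h14 ?h23 ?h24 ?h34 // adj_sym
    ?h12 ?h13 ?h14 ?h23 ?h24 ?h34 //.
- exact: inout.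
- by have := inout w v wP vP; rewrite adj_sym; case: (k v); case: (k w).
- exact: adjo.
Qed.

Lemma free_type_row (G : sgraph) (p1 p2 p3 p4 v : G) t :
  let path := [:: p1; p2; p3; p4] in
  conf_of path = path_conf ->
  (forall v, v \notin path -> [seq adj v p | p <- path] \in outer_rows) ->
  vertex_type p1 p2 p3 p4 v = t -> t = Out \/ t = All \/ t = Mid ->
  v \notin path /\ [seq adj v p | p <- path] = type_row t.
Proof.
move=> path cP rows kv tE; have vP : v \notin path.
  apply/negP => h; move: kv; case: cP => h12 h13 h14 h23 h24 h34.
  move: h; rewrite !inE => /or4P[]/eqP->; rewrite /vertex_type /= ?adj_irr;
    rewrite ?[adj p2 p1]adj_sym ?[adj p3 p1]adj_sym ?[adj p3 p2]adj_sym ?[adj p4 _]adj_sym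
      ?h12 ?h13 ?h14 ?h23 ?h24 ?h34 /= => E; by case: tE => [|[]]; rewrite -E.
split=> //; have := rows v vP; rewrite -kv /vertex_type -/path in tE *.
by rewrite !inE; do ?[case/predU1P=> [E|]]; try (move/eqP=> E); rewrite E /= in tE *;
  case: tE => [|[]].
Qed.

(** * Modules that are neither cliques nor stable *)

(** A single [x] carries both the edge and the nonedge; [mixedI] recovers this form from any edge
    and any nonadjacent pair. *)
Definition mixed (G : sgraph) (X : {set G}) : bool :=
  [exists x in X, exists y in X, exists z in X, [&& adj x y, x != z & ~~ adj x z]].

Lemma mixedP (G : sgraph) (X : {set G}) :
  reflect (exists x y z, [/\ x \in X, y \in X & z \in X] /\ [/\ adj x y, x != z & ~~ adj x z])
          (mixed X).
Proof.
apply: (iffP existsP) => [[x /andP[xX /existsP[y /andP[yX /existsP[z /andP[zX /and3P[*]]]]]]]|].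
  by exists x, y, z.
case=> x [y [z [[xX yX zX] [xy xz nxz]]]]; exists x; rewrite xX; apply/existsP; exists y.
by rewrite yX; apply/existsP; exists z; rewrite zX xy xz nxz.
Qed.

Lemma mixedI (G : sgraph) (X : {set G}) a b c d :
  a \in X -> b \in X -> c \in X -> d \in X -> adj a b -> c != d -> ~~ adj c d -> mixed X.
Proof.
move=> aX bX cX dX ab cd ncd; apply/mixedP; case: (eqVneq a c) => [ac|ac].
  by exists a, b, d; rewrite ac in ab *.
case: (boolP (adj a c)) => nac; last by exists a, b, c.
by exists c, a, d; rewrite adj_sym nac.
Qed.

Lemma mixed_compl (G : sgraph) (X : {set G}) : mixed X -> @mixed (compl G) X.
Proof.
case/mixedP=> x [y [z [[xX yX zX] [xy xz nxz]]]]; apply/mixedP; exists x, z, y.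
rewrite /= /compl_adj xz nxz /= xy andbF; split=> //; split=> //.
by apply: contraTneq xy => ->; rewrite adj_irr.
Qed.

(* Three vertices [x], [y], [z] of a module with [x ~ y] and [x !~ z], placed
   after a path that lies outside the module. *)
Definition mixed_conf (yz : bool) : conf :=
  conf_on 7 ([:: (0, 1); (1, 2); (2, 3); (4, 5);
                 (1, 4); (1, 5); (1, 6); (2, 4); (2, 5); (2, 6)] ++
             if yz then [:: (5, 6)] else [::]).

Definition module_row (p : seq bool) : bool := constant (drop 4 p).

Definition module_adj (t : vtype) : option bool :=
  match t with Y0 | Y1 | Out => Some false | Z0 | Z1 | All => Some true | Mid => None end.

Lemma module_adj_mid t b : agrees (module_adj t) b -> agrees (type_adj Mid t) b.
Proof. by case: t. Qed.

(** Here [p] is the row of one outside vertex and [q] that of a second, headed by the adjacency of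
    the two; [module_row] says that the module is not split. *)
Definition mixed_conf_ok (yz : bool) : bool :=
  all (fun p => if module_row p then
      [&& take 4 p \in outer_rows,
          agrees (module_adj (type_of_row (take 4 p))) (nth false p 4) &
          all (fun q => if module_row (behead q) then
              agrees (type_adj (type_of_row (take 4 p)) (type_of_row (take 4 (behead q))))
                     (head false q) else true)
            (exts fork_table (p :: mixed_conf yz))]
    else true)
  (exts fork_table (mixed_conf yz)).

Lemma mixed_conf_okT yz : mixed_conf_ok yz.
Proof. by case: yz; vm_compute. Qed.

Lemma mixed_conf_extend yz p b : size p = 4 ->
  p ++ nseq 3 b \in exts fork_table (mixed_conf yz) ->
  [/\ p \in outer_rows, agrees (module_adj (type_of_row p)) b &
    forall q c d, size q = 4 ->
      d :: q ++ nseq 3 c \in exts fork_table ((p ++ nseq 3 b) :: mixed_conf yz) ->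
      agrees (type_adj (type_of_row p) (type_of_row q)) d].
Proof.
move=> sp inp; have /allP/(_ _ inp) := mixed_conf_okT yz.
have mr q c : size q = 4 -> module_row (q ++ nseq 3 c).
  by move=> sq; rewrite /module_row drop_size_cat //= !eqxx.
rewrite mr // take_size_cat // nth_cat sp /= => /and3P[h1 h2 /allP h3]; split=> // q c d sq inq.
by have := h3 _ inq; rewrite /= mr // take_size_cat.
Qed.

Section MixedModule.
Variables (G : sgraph) (hG : fork_free G) (X : {set G}) (mX : is_module X).
Variables (x y z : G).
Hypotheses (xX : x \in X) (yX : y \in X) (zX : z \in X).
Hypotheses (xy : adj x y) (xz : x != z) (nxz : ~~ adj x z).

Let homog v u : v \notin X -> u \in X -> adj v u = adj v x.
Proof. by move=> vX uX; apply: (moduleP _ mX). Qed.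

(** The nonadjacent [x] and [z] would be leaves at [n] of a fork continuing along [n], [m], [m']. *)
Lemma outside_step n m m' : n \notin X -> m \notin X -> m' \notin X ->
  adj n x -> ~~ adj m x -> ~~ adj m' x -> adj m m' -> adj n m -> adj n m'.
Proof.
move=> nX mX' m'X nx mx m'x mm' nm; apply/negPn/negP => nm'.
apply: (no_fork hG (a := x) (b := n) (c := m) (d := m') (e := z)) => //.
- by rewrite adj_sym.
- by rewrite homog.
- by rewrite adj_sym.
- by rewrite adj_sym.
- by rewrite homog.
- by rewrite homog.
Qed.

End MixedModule.

(** This is [outside_step] in the complement, where the edge [x y] serves as the nonadjacent
    pair. *)
Lemma outside_costep (G : sgraph) (X : {set G}) (x y v n n' : G) :
  fork_free G -> is_module X -> x \in X -> y \in X -> adj x y ->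
  v \notin X -> n \notin X -> n' \notin X -> ~~ adj v x -> adj n x -> adj n' x ->
  n != n' -> ~~ adj n n' -> ~~ adj v n -> ~~ adj v n'.
Proof.
move=> hG mX xX yX xy vX nX nX' vx nx nx' nn' nnn' vn.
have mX' : @is_module (compl G) X by rewrite is_module_compl.
have ne u w : u \notin X -> w \in X -> u != w by move=> uX wX; apply: contraNneq uX => ->.
have cadjE (u w : G) : u != w -> @adj (compl G) u w = ~~ adj u w.
  by move=> uw; rewrite /= /compl_adj uw.
have vn1 : v != n by apply: contraTneq nx => <-.
have vn2 : v != n' by apply: contraTneq nx' => <-.
have yx : x != y by apply: contraTneq xy => ->; rewrite adj_irr.
rewrite -cadjE //.
apply: (@outside_step (compl G) (fork_free_compl hG) X mX' x y xX yX yx _ v n n') => //.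
- by rewrite cadjE // xy.
- by rewrite cadjE // ne.
- by rewrite cadjE ?ne // nx.
- by rewrite cadjE ?ne // nx'.
- by rewrite cadjE.
- by rewrite cadjE.
Qed.

Section MixedPath.
Variables (G : sgraph) (hG : fork_free G) (X : {set G}) (mX : is_module X).
Variables (x y z : G).
Hypotheses (xX : x \in X) (yX : y \in X) (zX : z \in X).
Hypotheses (xy : adj x y) (xz : x != z) (nxz : ~~ adj x z).
Variables (p1 p2 p3 p4 : G).
Let path := [:: p1; p2; p3; p4].
Hypotheses (cP : conf_of path = path_conf) (PX : {in path, forall p, p \notin X}).
Hypothesis PxE : [seq adj p x | p <- path] = [:: false; true; true; false].

Let homog v u : v \notin X -> u \in X -> adj v u = adj v x.
Proof. by move=> vX uX; apply: (moduleP _ mX). Qed.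

Let pX : [/\ p1 \notin X, p2 \notin X, p3 \notin X & p4 \notin X].
Proof. by split; apply: PX; rewrite !inE eqxx ?orbT. Qed.

Let px : [/\ adj p1 x = false, adj p2 x, adj p3 x & adj p4 x = false].
Proof. by case: PxE => -> -> -> ->. Qed.

Let row_in v : v \in X -> [seq adj v p | p <- path] = [:: false; true; true; false].
Proof.
move=> vX; case: pX => x1 x2 x3 x4; case: px => h1 h2 h3 h4.
by rewrite /= ![adj v _]adj_sym !homog // h1 h2 h3 h4.
Qed.

Let vs := path ++ [:: x; y; z].

Let confE : conf_of vs = mixed_conf (adj y z).
Proof.
case: pX => x1 x2 x3 x4; case: px => h1 h2 h3 h4.
case: cP => h12 h13 h14 h23 h24 h34.
rewrite /= (homog x1 yX) (homog x2 yX) (homog x3 yX) (homog x4 yX) (homog x1 zX)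
  (homog x2 zX) (homog x3 zX) (homog x4 zX) h1 h2 h3 h4 h12 h13 h14 h23 h24 h34 xy.
by rewrite (negbTE nxz); case: (adj y z).
Qed.

Let uvs : uniq vs.
Proof.
rewrite cat_uniq; apply/and3P; split.
- by apply: (@separated_uniq _ p1 [::]); rewrite // cP.
- rewrite -all_predC; apply/allP => u uX; apply/negP => /PX; move: uX.
  by rewrite !in_cons in_nil orbF => /or3P[]/eqP->; rewrite ?xX ?yX ?zX.
rewrite /= !inE negb_or xz andbT; apply/andP; split.
  by apply: contraTneq xy => <-; rewrite adj_irr.
by rewrite andbT; apply: contraTneq xy => ->.
Qed.

Let k := vertex_type p1 p2 p3 p4.

Let row v := [seq adj v p | p <- path].

Let row_vs v : v \notin X -> [seq adj v u | u <- vs] = row v ++ nseq 3 (adj v x).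
Proof. by move=> vX; rewrite map_cat /= (homog vX yX) (homog vX zX). Qed.

Let notin_vs v : v \notin path -> v \notin X -> v \notin vs.
Proof.
move=> vP vX; rewrite mem_cat negb_or vP /= !in_cons in_nil orbF !negb_or.
by apply/and3P; split; apply: contraNneq vX => ->.
Qed.

Let outer v : v \notin path -> v \notin X ->
  [/\ row v \in outer_rows, agrees (module_adj (k v)) (adj v x) &
    forall w, w \notin path -> w \notin X -> v != w ->
      agrees (type_adj (k v) (k w)) (adj v w)].
Proof.
move=> vP vX; have uv : uniq (v :: vs) by rewrite (cons_uniq v vs) notin_vs.
have := fork_exts hG uv; rewrite row_vs // confE => inv.
have [//|h1 h2 h3] := mixed_conf_extend _ inv; split=> // w wP wX vw.
have uw : uniq (w :: v :: vs).
  by rewrite (cons_uniq w (v :: vs)) uv andbT in_cons negb_or eq_sym vw notin_vs.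
have conf2 : conf_of (v :: vs) = [seq adj v u | u <- vs] :: conf_of vs by [].
have row2 : [seq adj w u | u <- v :: vs] = adj w v :: [seq adj w u | u <- vs] by [].
have := fork_exts hG uw; rewrite conf2 row2 !row_vs // confE => /h3.
by rewrite [adj v w]adj_sym; apply.
Qed.

Let k_in v : v \in X -> k v = Mid.
Proof. by move=> vX; rewrite /k /vertex_type -/path row_in. Qed.

Lemma blowup_of_mixed : blowup k p1 p2 p3 p4.
Proof.
have sym s t b : agrees (type_adj s t) b = agrees (type_adj t s) b by case: s; case: t.
have rows v : v \notin path -> row v \in outer_rows.
  move=> vP; case: (boolP (v \in X)) => vX; first by rewrite /row row_in.
  by case: (outer vP vX).
have free v t := free_type_row (v := v) (t := t) cP rows.
have row_free v t : k v = t -> t = Out \/ t = All \/ t = Mid -> row v = type_row t.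
  by move=> kv tE; case: (free v t kv tE).
have far v t b : k v = t -> t = Out \/ t = All -> module_adj t = Some b ->
    v \notin X /\ adj v x = b.
  move=> kv tE ab; have vX : v \notin X.
    by apply/negP => vX; move: kv; rewrite k_in // => E; case: tE; rewrite -E.
  split=> //; have [vP _] : v \notin path /\ row v = type_row t.
    by apply: free kv _; case: tE => ->; auto.
  by have [_ + _] := outer vP vX; rewrite kv ab => /eqP.
have [x1 x2 x3 x4] := pX; have [h1 h2 h3 h4] := px.
apply: blowup_of_rows => //.
- move=> v w vP wP vw; case: (boolP (v \in X)) => vX; case: (boolP (w \in X)) => wX.
  + by rewrite -/k !k_in.
  + rewrite -/k (k_in vX); have [_ /module_adj_mid + _] := outer wP wX.
    by rewrite [adj v w]adj_sym (homog wX vX).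
  + rewrite -/k (k_in wX) sym; have [_ /module_adj_mid + _] := outer vP vX.
    by rewrite (homog vX wX).
  + by have [_ _] := outer vP vX; apply.
- move=> o o' r ko ko' kr oo' ro.
  have [oX ox] := far o Out false ko (or_introl erefl) erefl.
  have [oX' ox'] := far o' Out false ko' (or_introl erefl) erefl.
  have rX : r \notin X by apply: contraL ro => rX; rewrite adj_sym (homog oX rX) ox.
  case rx: (adj r x).
    by apply: (outside_step hG mX xX zX xz nxz) ro; rewrite ?ox ?ox' ?rx.
  have [_ or2 _ _] := row_free o Out ko (or_introl erefl).
  have [_ rr2 _ _] := row_free r Mid kr (or_intror (or_intror erefl)).
  (* Now [r] misses the module, so [outside_step] carries the adjacency of [p2] from [r] to [o],
     although [o] misses the path. *)
  have : adj p2 o.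
    by apply: (outside_step hG mX xX zX xz nxz) x2 rX oX _ _ _ ro _;
      rewrite ?rx ?ox // adj_sym.
  by rewrite adj_sym or2.
move=> a a' r ka ka' kr aa' naa' ra; apply/negP => ra'.
have [aX ax] := far a All true ka (or_intror erefl) erefl.
have [aX' ax'] := far a' All true ka' (or_intror erefl) erefl.
have rX : r \notin X by apply: contraNN ra => rX; rewrite adj_sym (homog aX rX) ax.
have [a1 _ _ _] := row_free a All ka (or_intror (or_introl erefl)).
have [r1 _ _ _] := row_free r Mid kr (or_intror (or_intror erefl)).
(* In both cases the adjacent members [x] and [y] of the module act as the adjacent twins of an
   antifork. *)
case rx: (adj r x).
  apply: (no_antifork hG (a := r) (b := x) (c := a) (d := p1) (e := y)) => //.
  - by rewrite adj_sym.
  - by rewrite (homog rX yX).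
  - by rewrite (homog aX yX).
  - by rewrite r1.
  - by rewrite adj_sym h1.
  - by rewrite (homog x1 yX) h1.
apply: (no_antifork hG (a := a) (b := x) (c := a') (d := r) (e := y)) => //.
- by rewrite adj_sym.
- by rewrite adj_sym.
- by rewrite (homog aX yX).
- by rewrite (homog aX' yX).
- by rewrite adj_sym.
- by rewrite adj_sym rx.
- by rewrite (homog rX yX) rx.
Qed.
End MixedPath.

Section MixedExistence.
Variables (G : sgraph) (hG : fork_free G) (cG : connected G) (cG' : connected (compl G)).
Variables (X : {set G}) (mX : is_module X) (XT : X != [set: G]).
Variables (x y z : G).
Hypotheses (xX : x \in X) (yX : y \in X) (zX : z \in X).
Hypotheses (xy : adj x y) (xz : x != z) (nxz : ~~ adj x z).

Let homog v u : v \notin X -> u \in X -> adj v u = adj v x.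
Proof. by move=> vX uX; apply: (moduleP _ mX). Qed.

Let N : {set G} := [set v | (v \notin X) && adj v x].
Let M : {set G} := [set v | (v \notin X) && ~~ adj v x].
Let A (n : G) : {set G} := [set m in M | adj n m].

Let NMX v : [|| v \in X, v \in N | v \in M].
Proof. by rewrite !inE; case: (v \in X) => //=; case: (adj v x). Qed.

Let stepM n m m' : n \in N -> m \in M -> m' \in M -> adj m m' -> adj n m -> adj n m'.
Proof.
rewrite !inE => /andP[nX nx] /andP[mX1 mx] /andP[mX2 mx'].
exact: (outside_step hG mX xX zX xz nxz).
Qed.

Let stepN m n n' : m \in M -> n \in N -> n' \in N -> n != n' -> ~~ adj n n' ->
  ~~ adj n m -> ~~ adj n' m.
Proof.
rewrite !inE => /andP[mX1 mx] /andP[nX1 nx] /andP[nX2 nx'] nn' nnn'.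
rewrite ![adj _ m]adj_sym; exact: (outside_costep hG mX xX yX xy mX1 nX1 nX2).
Qed.

(** Take [n0] in [N] with most neighbours in [M]. It misses some [m1], since the complement is
    connected; some [n1] in [N] sees [m1], since [G] is connected; and maximality gives [m0] seen by
    [n0] but not by [n1]. The path is [m0], [n0], [n1], [m1]. *)
Lemma mixed_path : exists p1 p2 p3 p4, [/\ conf_of [:: p1; p2; p3; p4] = path_conf,
  {in [:: p1; p2; p3; p4], forall p, p \notin X} &
  [seq adj p x | p <- [:: p1; p2; p3; p4]] = [:: false; true; true; false]].
Proof.
have [o oX] : exists o, o \notin X.
  apply/existsP; rewrite -negb_forall; apply: contra XT => /forallP h.
  by apply/eqP/setP => v; rewrite in_setT h.
have [t [n [tX nX tn]]] := connected_crossing cG xX oX.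
have nN : n \in N by rewrite inE nX -(homog nX tX) adj_sym tn.
have [n0 n0N max] := @arg_maxnP _ n (fun v => v \in N) (fun v => #|A v|) nN.
have [m1 m1M n0m1] : exists2 m, m \in M & ~~ adj n0 m.
  apply/exists_inP; rewrite -negb_forall_in; apply/negP => /forall_inP full.
  pose T := [set v in N | [forall m in M, adj v m]].
  have n0T : n0 \in T by rewrite inE n0N; apply/forall_inP.
  have [u [w [uT wT]]] : exists u w : G, [/\ u \in T, w \notin T & @adj (compl G) u w].
    by apply: (@connected_crossing (compl G) T n0 x) => //; rewrite !inE xX.
  rewrite /= /compl_adj => /andP[uw nuw]; move: uT; rewrite inE => /andP[uN /forall_inP fu].
  have uX : u \notin X by move: uN; rewrite inE => /andP[].
  have ux : adj u x by move: uN; rewrite inE => /andP[].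
  case/or3P: (NMX w) => wh.
  - by rewrite (homog uX wh) ux in nuw.
  - case/negP: wT; rewrite inE wh; apply/forall_inP => m mM; apply/negPn/negP => wm.
    have := stepN mM wh uN _ _ wm; rewrite eq_sym uw adj_sym nuw fu // => /(_ isT isT).
    by [].
  - by rewrite fu in nuw.
have [n1 n1N n1m1] : exists2 v, v \in N & adj v m1.
  apply/exists_inP; apply: contraT => nex.
  have none v : v \in N -> ~~ adj v m1.
    by move=> vN; apply: contra nex => h; apply/exists_inP; exists v.
  pose T := [set m in M | [forall v in N, ~~ adj v m]].
  have m1T : m1 \in T by rewrite inE m1M; apply/forall_inP.
  have [|u [w [uT wT uw]]] := @connected_crossing G T m1 x cG m1T.
    by rewrite !inE xX.
  move: uT; rewrite inE => /andP[uM /forall_inP fu].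
  have uX : u \notin X by move: uM; rewrite inE => /andP[].
  have ux : ~~ adj u x by move: uM; rewrite inE => /andP[].
  case/or3P: (NMX w) => wh.
  - by rewrite -(homog uX wh) uw in ux.
  - by move: (fu w wh); rewrite adj_sym uw.
  - case/negP: wT; rewrite inE wh; apply/forall_inP => v vN; apply: contra (fu v vN).
    by apply: stepM; rewrite // adj_sym.
have [m0 m0A m0n1] : exists2 m, m \in A n0 & m \notin A n1.
  apply/subsetPn; apply/negP => sub.
  have : A n0 \proper A n1.
    apply/properP; split=> //; exists m1; first by rewrite inE m1M.
    by rewrite inE (negbTE n0m1) andbF.
  by move/proper_card; rewrite ltnNge => /negP[]; apply: max.
have [m0M n0m0] : m0 \in M /\ adj n0 m0 by move: m0A; rewrite inE => /andP[].
have {}m0n1 : ~~ adj n1 m0 by move: m0n1; rewrite inE m0M.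
have n0n1 : adj n0 n1.
  apply/negPn/negP => nn; have n10 : n1 != n0 by apply: contraNneq m0n1 => ->.
  have := stepN m0M n1N n0N n10 _ m0n1; rewrite adj_sym nn n0m0 => /(_ isT).
  by [].
have m0m1 : ~~ adj m0 m1.
  by apply/negP => mm; case/negP: n0m1; apply: stepM mm n0m0.
exists m0, n0, n1, m1; move: n0N n1N m0M m1M.
rewrite !inE => /andP[n0X n0x] /andP[n1X n1x] /andP[m0X m0x] /andP[m1X m1x]; split.
- by rewrite /= ![adj m0 _]adj_sym n0m0 n0n1 n1m1 (negbTE m0n1) (negbTE n0m1) [adj m1 m0]adj_sym (negbTE m0m1).
- by move=> p; rewrite !inE => /or4P[]/eqP->.
- by rewrite /= n0x n1x (negbTE m0x) (negbTE m1x).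
Qed.

End MixedExistence.

Theorem mixed_module_candled (G : sgraph) (X : {set G}) :
  fork_free G -> connected G -> connected (compl G) ->
  is_module X -> X != [set: G] -> mixed X -> candled G \/ candled (compl G).
Proof.
move=> hG cG cG' mX0 XT0 xX0.
pose P (V : {set G}) := [&& is_module V, V != [set: G] & mixed V].
have PX : P X by rewrite /P mX0 XT0.
have [V /and3P[mV VT /mixedP[x [y [z [[xV yV zV] [xy xz nxz]]]]]] max] :=
  @arg_maxnP _ X P (fun V : {set G} => #|V|) PX.
have [p1 [p2 [p3 [p4 [cP PV Px]]]]] := mixed_path hG cG cG' mV VT xV yV zV xy xz nxz.
have kG := blowup_of_mixed hG mV xV yV zV xy xz nxz cP PV Px.
case: (blowup_candled hG kG) => [|[|[W [mW WT kW]]]]; [by left|by right|].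
(* Members of [V] have type [Mid], so [W] contains [V] and also [p1]; being still mixed, it
   contradicts the maximality of [V]. *)
have VW : V \subset W.
  apply/subsetP => v vV; have pV p : p \in [:: p1; p2; p3; p4] -> adj v p = adj p x.
    by move=> pin; rewrite adj_sym; apply: (moduleP _ mV) => //; apply: PV.
  have kv : vertex_type p1 p2 p3 p4 v = Mid.
    rewrite /vertex_type; have -> : [seq adj v p | p <- [:: p1; p2; p3; p4]] =
      [seq adj p x | p <- [:: p1; p2; p3; p4]] by apply/eq_in_map.
    by rewrite Px.
  by apply: kW; rewrite kv.
have p1W : p1 \in W by apply: kW; rewrite (bl1 kG).
have : #|W| <= #|V|.
  apply: max; rewrite /P mW WT; apply/mixedP; exists x, y, z.
  by rewrite !(subsetP VW).
rewrite leqNgt => /negP[]; apply: proper_card; apply/properP; split=> //.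
by exists p1 => //; apply: PV; rewrite mem_head.
Qed.

(** * Twins *)

Definition twin (G : sgraph) (u u' : G) : bool := (u != u') && is_module [set u; u'].

Lemma twin_adj (G : sgraph) (u u' w : G) :
  twin u u' -> w != u -> w != u' -> adj w u' = adj w u.
Proof.
case/andP=> _ /moduleP m wu wu'; apply: m; rewrite !inE ?eqxx ?orbT //.
by rewrite negb_or wu.
Qed.

Lemma twin_sym (G : sgraph) (u u' : G) : twin u u' = twin u' u.
Proof. by rewrite /twin eq_sym setUC. Qed.

Lemma twin_compl (G : sgraph) (u u' : G) : @twin (compl G) u u' = twin u u'.
Proof. by rewrite /twin is_module_compl. Qed.

(** If [u = t], the nonadjacent twin [t'] sees [u'] as [u] does, and then must see [u], because [u]
    and [u'] are twins. *)
Lemma twin_clash (G : sgraph) (u u' t t' : G) :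
  twin u u' -> adj u u' -> twin t t' -> ~~ adj t t' -> u != t.
Proof.
move=> uu auu tt att; apply/eqP => E; rewrite -{}E in tt att.
have tu' : t' != u' by apply: contraNneq att => ->.
have [u_u' u_t'] : u != u' /\ u != t' by case/andP: uu => -> _; case/andP: tt.
have := twin_adj uu _ tu'; rewrite eq_sym => /(_ u_t').
by rewrite [adj t' u']adj_sym (twin_adj tt) 1?eq_sym // adj_sym auu adj_sym (negbTE att).
Qed.

Lemma twins_in_module (G : sgraph) (T : {set G}) (t t' : G) :
  is_module T -> ~~ mixed T -> t \in T -> t' \in T -> t != t' -> twin t t'.
Proof.
move=> mT nT tT tT' tt; rewrite /twin tt; apply/moduleP => w y z.
rewrite !inE negb_or => /andP[wt wt'] yt zt; case: (boolP (w \in T)) => wT; last first.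
  by apply: (moduleP _ mT) => //; [case/orP: yt|case/orP: zt] => /eqP->.
have key p q : p \in T -> q \in T -> w != q -> adj w p -> adj w q.
  by move=> pT qT wq wp; apply: contraNT nT => nwq; apply/mixedP; exists w, p, q.
by case/orP: yt => /eqP->; case/orP: zt => /eqP-> //; apply/idP/idP; apply: key.
Qed.

Section Anti.
Variables (G : sgraph) (hG : fork_free G).
Hypothesis pure : forall X : {set G}, is_module X -> X != [set: G] -> ~~ mixed X.

(** The set is the anticomponent of [a] among the neighbours of [u] other than [u']. By
    [outside_costep] for the module formed by [u] and [u'], no vertex splits it; as it contains the
    nonadjacent pair [a], [b], being unmixed makes it stable. *)
Lemma stable_module_of_twins u u' a b : twin u u' -> adj u u' ->
  adj u a -> adj u b -> a != u' -> b != u' -> a != b -> ~~ adj a b ->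
  exists T : {set G}, [/\ is_module T, ~~ mixed T, a \in T, b \in T &
    {in T, forall t, adj u t} /\ forall w t, t \in T -> adj u w -> w != u' -> ~~ adj w t -> w \in T].
Proof.
move=> uu auu ua ub au' bu' ab nab; pose N : {set G} := [set w | adj u w & w != u'].
have aN : a \in N by rewrite inE ua.
have bN : b \in N by rewrite inE ub.
have mX : is_module [set u; u'] by case/andP: uu.
have nX w : w \in N -> w \notin [set u; u'].
  rewrite !inE negb_or => /andP[uw ->]; rewrite andbT.
  by apply: contraTneq uw => ->; rewrite adj_irr.
have mT : is_module (anticomp N a).
  apply: anticomp_module => // v vN y z yN zN yz.
  case: (eqVneq y z) => [-> //|ne].
  have [uy uz] : adj u y /\ adj u z by move: yN zN; rewrite !inE => /andP[-> _] /andP[-> _].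
  case: (boolP (v \in [set u; u'])) => vX.
    move: (nX y yN) (nX z zN); rewrite !inE !negb_or => /andP[y1 y2] /andP[z1 z2].
    move: vX; rewrite !inE => /orP[]/eqP->; first by rewrite uy uz.
    by rewrite ![adj u' _]adj_sym !(twin_adj uu) // ![adj _ u]adj_sym uy uz.
  have vu : ~~ adj v u.
    move: vN vX; rewrite !inE negb_or => /nandP[|]; first by rewrite adj_sym.
    by rewrite negbK => ->; rewrite andbF.
  have step := @outside_costep G [set u; u'] u u' v _ _ hG mX _ _ auu vX _ _ vu.
  have [uX uX'] : u \in [set u; u'] /\ u' \in [set u; u'] by rewrite !inE !eqxx orbT.
  apply/idP/idP; apply: contraTT => h.
    by apply: (step z y); rewrite ?nX // 1?adj_sym // 1?eq_sym // adj_sym.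
  by apply: (step y z); rewrite ?nX // adj_sym.
have sub := subsetP (anticomp_sub aN).
exists (anticomp N a); split.
- exact: mT.
- apply: pure => //; apply/negP => /eqP E; have := in_setT u; rewrite -E => /sub.
  by rewrite inE adj_irr.
- exact: anticomp_refl.
- by apply: anticomp_step nab; rewrite ?anticomp_refl.
split=> [t /sub|w t tT uw wu' wt]; first by rewrite inE => /andP[].
by apply: anticomp_step tT _ _; rewrite // ?inE ?uw // adj_sym.
Qed.

End Anti.

(** Vertex [i + 4] is the twin of vertex [i]; the extra edges make the twins of the ends adjacent,
    those of the inner vertices staying nonadjacent. *)
Definition twin_conf : conf :=
  conf_on 8 (flatten [seq [:: e; (e.1, e.2 + 4); (e.1 + 4, e.2); (e.1 + 4, e.2 + 4)]
                     | e <- [:: (0, 1); (1, 2); (2, 3)]] ++ [:: (0, 4); (3, 7)]).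

Definition twin_row (p : seq bool) : bool := take 4 p == drop 4 p.

Lemma twin_conf_ok :
  all (fun p => if twin_row p then
      (take 4 p \in outer_rows) &&
      all (fun q => if twin_row (behead q) then
              agrees (type_adj (type_of_row (take 4 p)) (type_of_row (take 4 (behead q))))
                     (head false q) else true)
            (exts fork_table (p :: twin_conf))
    else true)
  (exts fork_table twin_conf).
Proof. vm_cast_no_check (erefl true). Qed.

Lemma twin_conf_extend p : size p = 4 -> p ++ p \in exts fork_table twin_conf ->
  p \in outer_rows /\
    forall q d, size q = 4 ->
      d :: q ++ q \in exts fork_table ((p ++ p) :: twin_conf) ->
      agrees (type_adj (type_of_row p) (type_of_row q)) d.
Proof.
move=> sp inp; have /allP/(_ _ inp) := twin_conf_ok.
have tr q : size q = 4 -> twin_row (q ++ q).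
  by move=> sq; rewrite /twin_row take_size_cat // drop_size_cat.
rewrite (tr p sp) (take_size_cat p sp) => /andP[h1 /allP h3]; split=> // q d sq inq.
by have := h3 _ inq; rewrite [behead _]/= (tr q sq) (take_size_cat q sq).
Qed.

Section TwinPath.
Variables (G : sgraph) (hG : fork_free G).
Variables (p1 p2 p3 p4 q1 q2 q3 q4 : G).
Let path := [:: p1; p2; p3; p4].
Let path' := [:: q1; q2; q3; q4].
Hypotheses (cP : conf_of (path ++ path') = twin_conf) (uP : uniq (path ++ path')).
Hypotheses (t1 : twin p1 q1) (t2 : twin p2 q2) (t3 : twin p3 q3) (t4 : twin p4 q4).

Let k := vertex_type p1 p2 p3 p4.
Let row v := [seq adj v p | p <- path].

Let notin2 v : v \notin path -> v \notin path' -> v \notin path ++ path'.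
Proof. by move=> h h'; rewrite mem_cat negb_or h. Qed.

Let row_twin v : v \notin path -> v \notin path' ->
  [seq adj v u | u <- path ++ path'] = row v ++ row v.
Proof.
rewrite map_cat !in_cons !in_nil !orbF !negb_or => /and4P[n1 n2 n3 n4] /and4P[m1 m2 m3 m4].
by congr (_ ++ _); rewrite /row /= !(twin_adj t1, twin_adj t2, twin_adj t3, twin_adj t4).
Qed.

Let outer v : v \notin path -> v \notin path' -> row v \in outer_rows /\
  forall w, w \notin path -> w \notin path' -> v != w ->
    agrees (type_adj (k v) (k w)) (adj v w).
Proof.
move=> vP vP'; have uv : uniq (v :: (path ++ path')).
  by rewrite (cons_uniq v (path ++ path')) notin2.
have := fork_exts hG uv; rewrite row_twin // cP => inv.
have [//|h1 h3] := twin_conf_extend _ inv; split=> // w wP wP' vw.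
have uw : uniq (w :: v :: (path ++ path')).
  rewrite (cons_uniq w (v :: (path ++ path'))) uv andbT in_cons negb_or eq_sym vw.
  exact: notin2.
have conf2 : conf_of (v :: (path ++ path')) =
  [seq adj v u | u <- path ++ path'] :: conf_of (path ++ path') by [].
have row2 : [seq adj w u | u <- v :: (path ++ path')] =
  adj w v :: [seq adj w u | u <- path ++ path'] by [].
have := fork_exts hG uw; rewrite conf2 row2 !row_twin // cP => /h3.
by rewrite [adj v w]adj_sym; apply.
Qed.

Let cpath : conf_of path = path_conf.
Proof.
have := conf_of_mask (nseq 4 true ++ nseq 4 false) (path ++ path').
by rewrite cP.
Qed.

Let row_inner v : v \in path' -> row v \in outer_rows.
Proof.
have adjs i j : i < 8 -> j < 8 -> cadj twin_conf i j =
    adj (nth p1 (path ++ path') i) (nth p1 (path ++ path') j).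
  by rewrite -cP => *; rewrite (cadj_conf_of p1).
rewrite /row !in_cons in_nil orbF => /or4P[]/eqP->.
- by rewrite /= -(adjs 4 0) // -(adjs 4 1) // -(adjs 4 2) // -(adjs 4 3).
- by rewrite /= -(adjs 5 0) // -(adjs 5 1) // -(adjs 5 2) // -(adjs 5 3).
- by rewrite /= -(adjs 6 0) // -(adjs 6 1) // -(adjs 6 2) // -(adjs 6 3).
by rewrite /= -(adjs 7 0) // -(adjs 7 1) // -(adjs 7 2) // -(adjs 7 3).
Qed.

Let rows v : v \notin path -> row v \in outer_rows.
Proof.
move=> vP; case: (boolP (v \in path')) => vP'; first exact: row_inner.
by case: (outer vP vP').
Qed.

Let type_inner : [/\ k q1 = Y0, k q2 = Z0, k q3 = Z1 & k q4 = Y1].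
Proof.
have adjs i j : i < 8 -> j < 8 -> cadj twin_conf i j =
    adj (nth p1 (path ++ path') i) (nth p1 (path ++ path') j).
  by rewrite -cP => *; rewrite (cadj_conf_of p1).
rewrite /k /vertex_type /=; split.
- by rewrite -(adjs 4 0) // -(adjs 4 1) // -(adjs 4 2) // -(adjs 4 3).
- by rewrite -(adjs 5 0) // -(adjs 5 1) // -(adjs 5 2) // -(adjs 5 3).
- by rewrite -(adjs 6 0) // -(adjs 6 1) // -(adjs 6 2) // -(adjs 6 3).
by rewrite -(adjs 7 0) // -(adjs 7 1) // -(adjs 7 2) // -(adjs 7 3).
Qed.

Let inner_agrees v w : v \in path' -> w \notin path -> v != w ->
  agrees (type_adj (k v) (k w)) (adj v w).
Proof.
move=> vP wP vw; have /outer_rows_agree/and4P[c1 c2 c3 c4] := rows wP.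
have [k1 k2 k3 k4] := type_inner.
move: wP; rewrite !in_cons in_nil orbF !negb_or => /and4P[n1 n2 n3 n4].
rewrite adj_sym; move: vP vw; rewrite !in_cons in_nil orbF.
case/or4P=> /eqP-> vw; rewrite ?k1 ?k2 ?k3 ?k4.
- by rewrite (twin_adj t1) // eq_sym.
- by rewrite (twin_adj t2) // eq_sym.
- by rewrite (twin_adj t3) // eq_sym.
by rewrite (twin_adj t4) // eq_sym.
Qed.

(** For [bl_out] the nonadjacent twins [p2], [q2] supply two leaves of a fork; for [bl_all] the
    adjacent twins [p1], [q1] supply those of an antifork. *)
Lemma blowup_of_twins : blowup k p1 p2 p3 p4.
Proof.
have sym s t b : agrees (type_adj s t) b = agrees (type_adj t s) b by case: s; case: t.
have free v t := free_type_row (v := v) (t := t) cpath rows.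
have out : Out = Out \/ Out = All \/ Out = Mid by left.
have all : All = Out \/ All = All \/ All = Mid by right; left.
have mid : Mid = Out \/ Mid = All \/ Mid = Mid by right; right.
have p2q2 : ~~ adj p2 q2 /\ adj p1 q1.
  have adjs i j : i < 8 -> j < 8 -> cadj twin_conf i j =
      adj (nth p1 (path ++ path') i) (nth p1 (path ++ path') j).
    by rewrite -cP => *; rewrite (cadj_conf_of p1).
  by rewrite -(adjs 1 5) // -(adjs 0 4).
have [k1 k2 k3 k4] := type_inner.
have ne v w s t : k v = s -> k w = t -> s <> t -> v != w.
  by move=> <- <- st; apply/eqP => E; rewrite E in st.
apply: blowup_of_rows => //.
- move=> v w vP wP vw; case: (boolP (v \in path')) => vP'; first exact: inner_agrees.
  case: (boolP (w \in path')) => wP'.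
    by rewrite sym adj_sym; apply: inner_agrees; rewrite // eq_sym.
  by have [_] := outer vP vP'; apply.
- move=> o o' r ko ko' kr oo' ro.
  have [oP [o1 o2 _ _]] := free o Out ko out.
  have [oP' [o1' o2' _ _]] := free o' Out ko' out.
  have [rP [_ r2 _ _]] := free r Mid kr mid.
  apply/negPn/negP => nro'.
  have ne2 v : v \notin path -> v != p2.
    by rewrite !in_cons !negb_or => /and3P[].
  apply: (no_fork hG (a := p2) (b := r) (c := o) (d := o') (e := q2)) => //.
  + by case/andP: t2.
  + by rewrite adj_sym r2.
  + by rewrite (twin_adj t2) ?ne2 ?r2 // (ne _ _ _ _ kr k2).
  + by rewrite adj_sym o2.
  + by rewrite adj_sym o2'.
  + by case: p2q2.
  + by rewrite (twin_adj t2) ?ne2 ?o2 // (ne _ _ _ _ ko k2).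
  + by rewrite (twin_adj t2) ?ne2 ?o2' // (ne _ _ _ _ ko' k2).
move=> a a' r ka ka' kr aa' naa' ra; apply/negP => ra'.
have [aP [a1 _ _ _]] := free a All ka all.
have [aP' [a1' _ _ _]] := free a' All ka' all.
have [rP [r1 _ _ _]] := free r Mid kr mid.
have ne1 v : v \notin path -> v != p1.
  by rewrite !in_cons !negb_or => /andP[].
apply: (no_antifork hG (a := a) (b := p1) (c := a') (d := r) (e := q1)) => //.
- by rewrite adj_sym a1'.
- by rewrite adj_sym.
- by rewrite (twin_adj t1) ?ne1 ?a1 // (ne _ _ _ _ ka k1).
- by case: p2q2.
- by rewrite (twin_adj t1) ?ne1 ?a1' // (ne _ _ _ _ ka' k1).
- by rewrite adj_sym.
- by rewrite adj_sym r1.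
- by rewrite (twin_adj t1) ?ne1 ?r1 // (ne _ _ _ _ kr k1).
Qed.

End TwinPath.

Lemma mixed_complE (G : sgraph) (X : {set G}) : @mixed (compl G) X = mixed X.
Proof.
apply/idP/idP; last exact: mixed_compl.
case/mixedP=> x [y [z [[xX yX zX] []]]]; rewrite /= /compl_adj => /andP[xy nxy] xz.
by rewrite xz negbK => xz'; apply/mixedP; exists x, z, y.
Qed.

(** The form in which the absence of adjacent simplicial twins is used. *)
Definition rich_twins (G : sgraph) : Prop := forall u u' : G, twin u u' -> adj u u' ->
  exists a b, [/\ adj u a, adj u b, a != u', b != u' & a != b /\ ~~ adj a b].

Lemma twin_pairs_adj (G : sgraph) (p q r s : G) : twin p q -> twin r s ->
  p != r -> p != s -> q != r -> q != s ->
  [/\ adj p s = adj p r, adj q r = adj p r & adj q s = adj p r].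
Proof.
move=> pq rs pr ps qr qs; have rq : adj q r = adj p r.
  by rewrite adj_sym (twin_adj pq) 1?eq_sym // adj_sym.
by split; rewrite // (twin_adj rs).
Qed.

Section Pure.
Variables (G : sgraph) (hG : fork_free G).
Hypothesis pure : forall X : {set G}, is_module X -> X != [set: G] -> ~~ mixed X.
Hypotheses (rich : rich_twins G) (rich' : rich_twins (compl G)).

Let stable_module u u' : twin u u' -> adj u u' -> exists (T : {set G}) a b,
  [/\ is_module T, ~~ mixed T, a \in T, b \in T & [/\ a != b, ~~ adj a b,
    {in T, forall t, adj u t} &
    forall w t, t \in T -> adj u w -> w != u' -> ~~ adj w t -> w \in T]].
Proof.
move=> uu auu; have [a [b [ua ub au' bu' [ab nab]]]] := rich uu auu.
have [T [mT nT aT bT [cT sT]]] := stable_module_of_twins hG pure uu auu ua ub au' bu' ab nab.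
by exists T, a, b; split.
Qed.

Let clique_module t t' : twin t t' -> ~~ adj t t' -> exists (C : {set G}) c c',
  [/\ is_module C, ~~ mixed C, c \in C, c' \in C & [/\ c != c', adj c c',
    {in C, forall x, (t != x) && ~~ adj t x} &
    forall w x, x \in C -> t != w -> ~~ adj t w -> w != t' -> adj w x -> w \in C]].
Proof.
move=> tt att; have tne : t != t' by case/andP: tt.
have pure' (X : {set compl G}) : is_module X -> X != [set: compl G] -> ~~ mixed X.
  by rewrite is_module_compl mixed_complE; apply: pure.
have tt' : @twin (compl G) t t' by rewrite twin_compl.
have att' : @adj (compl G) t t' by rewrite /= /compl_adj tne.
have [a [b [ua ub au' bu' [ab nab]]]] := rich' tt' att'.
have [T [mT nT aT bT [cT sT]]] :=
  stable_module_of_twins (fork_free_compl hG) pure' tt' att' ua ub au' bu' ab nab.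
rewrite is_module_compl in mT; rewrite mixed_complE in nT.
exists T, a, b; split=> //; split=> //.
  by move: nab; rewrite /= /compl_adj ab negbK.
move=> w x xT tw ntw wt' wx; apply: (sT w x xT _ wt'); rewrite /= /compl_adj ?tw //.
by rewrite wx andbF.
Qed.

Let adjtwin (u : G) := [exists u', twin u u' && adj u u'].

Let A t : {set G} := [set u | adjtwin u & adj u t].

(** Among nonadjacent twin pairs take [t0], [t0'] with [A t0] largest. A clique module missed by
    [t0] gives adjacent twins [c], [c'], and a stable module seen by [c] gives nonadjacent twins
    [t1], [t1']. As [c] lies in [A t1] but not in [A t0], maximality gives [u] in [A t0] outside
    [A t1]; the path is [u], [t0], [t1], [c]. *)
Lemma twin_path (t t' : G) : @twin G t t' -> ~~ adj t t' ->
  exists p1 p2 p3 p4 q1 q2 q3 q4 : G, [/\ uniq ([:: p1; p2; p3; p4] ++ [:: q1; q2; q3; q4]),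
    conf_of ([:: p1; p2; p3; p4] ++ [:: q1; q2; q3; q4]) = twin_conf &
    [/\ twin p1 q1, twin p2 q2, twin p3 q3 & twin p4 q4]].
Proof.
move=> tt att; pose P (p : G * G) := @twin G p.1 p.2 && ~~ @adj G p.1 p.2.
have P0 : P (t, t') by rewrite /P tt.
have [[t0 t0'] /andP[/= tt0 att0] max] := @arg_maxnP _ (t, t') P (fun p => #|A p.1|) P0.
have [C [c [c' [mC nC cC cC' [cc acc antiC stepC]]]]] := clique_module tt0 att0.
have tcc : twin c c' := twins_in_module mC nC cC cC' cc.
have [T [t1 [t1' [mT nT t1T t1T' [tt1 att1 cT stepT]]]]] := stable_module tcc acc.
have ttt1 : twin t1 t1' := twins_in_module mT nT t1T t1T' tt1.
have [/andP[t0c nt0c] /andP[t0c' nt0c']] := (antiC c cC, antiC c' cC').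
have clash u u' v v' := @twin_clash G u u' v v'.
have t0t0 : twin t0' t0 by rewrite twin_sym.
(* [t1] is adjacent to [t0]: otherwise both [t1] and [t1'] would lie in the clique [C]. *)
have t0t1 : adj t0 t1.
  apply/negPn/negP => n01.
  have inC v : v \in T -> ~~ adj t0 v -> v \in C.
    move=> vT n; have cv := cT v vT; have vc : adj v c by rewrite adj_sym.
    apply: (stepC v c cC _ n _ vc); first by apply: contraTneq cv => <-; rewrite adj_sym.
    apply: contraTneq cv => ->; rewrite (twin_adj tt0) 1?eq_sym //.
    - by rewrite adj_sym.
    - by rewrite eq_sym; apply: (clash _ _ _ _ tcc acc t0t0); rewrite adj_sym.
  have t0T : t0 \notin T by apply: contra nt0c => /cT; rewrite adj_sym.
  have n01' : ~~ adj t0 t1' by rewrite (moduleP _ mT t0 t1' t1).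
  case/negP: nC; apply: (mixedI cC cC' (inC _ t1T n01) (inC _ t1T' n01') acc tt1 att1).
have cA1 : c \in A t1 by rewrite inE cT // andbT; apply/existsP; exists c'; rewrite tcc.
have cA0 : c \notin A t0 by rewrite inE adj_sym (negbTE nt0c) andbF.
have [u uA0 uA1] : exists2 u, u \in A t0 & u \notin A t1.
  apply/subsetPn/negP => sub.
  have pr : A t0 \proper A t1 by apply/properP; split=> //; exists c.
  by move: (proper_card pr); rewrite ltnNge => /negP[]; apply: (max (t1, t1')); rewrite /P ttt1.
move: uA0; rewrite inE => /andP[/existsP[u' /andP[tuu auu]] ut0].
have nut1 : ~~ adj u t1.
  by apply: contra uA1 => h; rewrite inE h andbT; apply/existsP; exists u'; rewrite tuu.
have t0T : t0 \notin T by apply: contra nt0c => /cT; rewrite adj_sym.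
have tuu' : twin u' u by rewrite twin_sym.
have auu' : adj u' u by rewrite adj_sym.
have tcc' : twin c' c by rewrite twin_sym.
have acc' : adj c' c by rewrite adj_sym.
have att0' : ~~ adj t0' t0 by rewrite adj_sym.
have ttt1' : twin t1' t1 by rewrite twin_sym.
have att1' : ~~ adj t1' t1 by rewrite adj_sym.
have [ne_ut0 ne_ut0' ne_ut1 ne_ut1'] : [/\ u != t0, u != t0', u != t1 & u != t1'].
  by split; [exact: (clash _ _ _ _ tuu auu tt0 att0)|exact: (clash _ _ _ _ tuu auu t0t0 att0')|
    exact: (clash _ _ _ _ tuu auu ttt1 att1)|exact: (clash _ _ _ _ tuu auu ttt1' att1')].
have [ne_u't0 ne_u't0' ne_u't1 ne_u't1'] : [/\ u' != t0, u' != t0', u' != t1 & u' != t1'].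
  by split; [exact: (clash _ _ _ _ tuu' auu' tt0 att0)|exact: (clash _ _ _ _ tuu' auu' t0t0 att0')|
    exact: (clash _ _ _ _ tuu' auu' ttt1 att1)|exact: (clash _ _ _ _ tuu' auu' ttt1' att1')].
have [ne_ct0 ne_ct0' ne_ct1 ne_ct1'] : [/\ c != t0, c != t0', c != t1 & c != t1'].
  by split; [exact: (clash _ _ _ _ tcc acc tt0 att0)|exact: (clash _ _ _ _ tcc acc t0t0 att0')|
    exact: (clash _ _ _ _ tcc acc ttt1 att1)|exact: (clash _ _ _ _ tcc acc ttt1' att1')].
have [ne_c't0 ne_c't0' ne_c't1 ne_c't1'] : [/\ c' != t0, c' != t0', c' != t1 & c' != t1'].
  by split; [exact: (clash _ _ _ _ tcc' acc' tt0 att0)|exact: (clash _ _ _ _ tcc' acc' t0t0 att0')|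
    exact: (clash _ _ _ _ tcc' acc' ttt1 att1)|exact: (clash _ _ _ _ tcc' acc' ttt1' att1')].
have [] := twin_pairs_adj tuu tt0 ne_ut0 ne_ut0' ne_u't0 ne_u't0'; rewrite ut0 => ut0' u't0 u't0'.
have [nct0 nc't0] : ~~ adj c t0 /\ ~~ adj c' t0 by rewrite ![adj _ t0]adj_sym.
have [ne_uc ne_uc'] : u != c /\ u != c'.
  by split; [apply: contraTneq ut0|apply: contraTneq ut0] => ->.
have [ne_u'c ne_u'c'] : u' != c /\ u' != c'.
  by split; [apply: contraNneq nct0|apply: contraNneq nc't0] => <-.
have ne_t0t1 : t0 != t1 by apply: contraNneq t0T => ->.
have ne_t0t1' : t0 != t1' by apply: contraNneq t0T => ->.
have nct0' : ~~ adj c t0' by rewrite (twin_adj tt0).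
have ne_t0't1 : t0' != t1 by apply: contraNneq nct0' => ->; apply: cT.
have ne_t0't1' : t0' != t1' by apply: contraNneq nct0' => ->; apply: cT.
(* Otherwise [u] would join the stable module [T] and have both an adjacent and a nonadjacent
   twin. *)
have nuc : ~~ adj u c.
  apply/negP => uc; have uT : u \in T by apply: (stepT u t1 t1T _ ne_uc' nut1); rewrite adj_sym.
  have tw : twin u t1 := twins_in_module mT nT uT t1T ne_ut1.
  by have := clash _ _ _ _ tuu auu tw nut1; rewrite eqxx.
have t1c : adj t1 c by rewrite adj_sym cT.
have [ne_t1c ne_t1c' ne_t1'c ne_t1'c'] : [/\ t1 != c, t1 != c', t1' != c & t1' != c'].
  by split; rewrite eq_sym.
have [ne_t0c ne_t0c' ne_t0'c ne_t0'c'] : [/\ t0 != c, t0 != c', t0' != c & t0' != c'].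
  by split; rewrite eq_sym.
exists u, t0, t1, c, u', t0', t1', c'; split=> //.
  rewrite /= !inE !negb_or ne_ut0 ne_ut1 ne_uc ne_ut0' ne_ut1' ne_uc' ne_t0t1 ne_t0c ne_t0t1' ne_t0c'.
  rewrite ne_t1c ne_t1c' ne_u't0' ne_u't1' ne_u'c' ne_t0't1' ne_t0'c' ne_t1'c'.
  rewrite ![_ == u']eq_sym ne_u't0 ne_u't1 ne_u'c [t1 == t0']eq_sym [c == t0']eq_sym ne_t0't1 ne_t0'c.
  rewrite [c == t1']eq_sym ne_t1'c.
  by case/andP: tuu' => ->; case/andP: tt0 => ->; case/andP: ttt1 => ->; case/andP: tcc => ->.
have [e12 e12' e12''] := twin_pairs_adj tuu tt0 ne_ut0 ne_ut0' ne_u't0 ne_u't0'.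
have [e13 e13' e13''] := twin_pairs_adj tuu ttt1 ne_ut1 ne_ut1' ne_u't1 ne_u't1'.
have [e14 e14' e14''] := twin_pairs_adj tuu tcc ne_uc ne_uc' ne_u'c ne_u'c'.
have [e23 e23' e23''] := twin_pairs_adj tt0 ttt1 ne_t0t1 ne_t0t1' ne_t0't1 ne_t0't1'.
have [e24 e24' e24''] := twin_pairs_adj tt0 tcc ne_t0c ne_t0c' ne_t0'c ne_t0'c'.
have [e34 e34' e34''] := twin_pairs_adj ttt1 tcc ne_t1c ne_t1c' ne_t1'c ne_t1'c'.
rewrite /= [adj t0 u']adj_sym [adj t1 u']adj_sym [adj t1 t0']adj_sym [adj c u']adj_sym.
rewrite [adj c t0']adj_sym [adj c t1']adj_sym.
rewrite e12 e12' e12'' e13 e13' e13'' e14 e14' e14'' e23 e23' e23'' e24 e24' e24'' e34 e34' e34''.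
rewrite ut0 (negbTE nut1) (negbTE nuc) t0t1 (negbTE nt0c) t1c auu acc (negbTE att0) (negbTE att1).
by [].
Qed.

Lemma pure_candled (t t' : G) : twin t t' -> ~~ adj t t' -> candled G \/ candled (compl G).
Proof.
move=> tt att; have [p1 [p2 [p3 [p4 [q1 [q2 [q3 [q4 [uP cP [t1 t2 t3 t4]]]]]]]]]] := twin_path tt att.
have kG := blowup_of_twins hG cP uP t1 t2 t3 t4.
case: (blowup_candled hG kG) => [|[|[V [mV VT kV]]]]; [by left|by right|].
have inV p s : vertex_type p1 p2 p3 p4 p = s -> s <> Out -> s <> All -> p \in V.
  by move=> kp sO sA; apply: kV; rewrite kp.
(* The proper module [V] contains the path, so it is mixed, against purity. *)
case: kG => k1 k2 k3 k4 _ _ _; case/negP: (pure mV VT).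
have adjs i j : i < 8 -> j < 8 -> cadj twin_conf i j =
    adj (nth p1 ([:: p1; p2; p3; p4] ++ [:: q1; q2; q3; q4]) i)
        (nth p1 ([:: p1; p2; p3; p4] ++ [:: q1; q2; q3; q4]) j).
  by rewrite -cP => *; rewrite (cadj_conf_of p1).
apply: (mixedI (inV _ _ k1 _ _) (inV _ _ k2 _ _) (inV _ _ k1 _ _) (inV _ _ k3 _ _)) => //.
- by rewrite -(adjs 0 1).
- by move: uP; rewrite /= !inE !negb_or => /and5P[/and4P[_ + _ _]].
- by rewrite -(adjs 0 2).
Qed.

End Pure.

(** * Assembly of the outcomes *)

Lemma connectedP (G : sgraph) : connected G \/ ~ connected G.
Proof.
case: (boolP [forall x : G, forall y : G, connect (@adj G) x y]) => [/forallP h|h].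
  by left=> x y; apply: (forallP (h x)).
by right=> c; case/negP: h; apply/forallP => x; apply/forallP => y.
Qed.

Lemma conf4P (G : sgraph) (H K : conf) : size H = 4 -> size K = 4 ->
  (has_conf G H \/ has_conf G K) \/ (~ has_conf G H /\ ~ has_conf G K).
Proof.
move=> sH sK.
have dec L : size L = 4 -> has_conf G L \/ ~ has_conf G L.
  move=> sL; case: (boolP [exists t : 4.-tuple G, uniq t && (conf_of t == L)]).
    by case/existsP=> t /andP[ut /eqP ct]; left; exists t.
  move=> no; right=> -[vs uvs cvs]; case/negP: no; apply/existsP.
  have svs : size vs == 4 by rewrite -size_conf_of cvs sL.
  by exists (Tuple svs); rewrite uvs cvs eqxx.
by case: (dec H sH) (dec K sK) => ? [?|?]; auto.
Qed.

Lemma rich_twinsP (G : sgraph) : has_adjacent_simplicial_twins G \/ rich_twins G.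
Proof.
pose witness (u u' : G) :=
  [exists a, exists b, [&& adj u a, adj u b, a != u', b != u', a != b & ~~ adj a b]].
case: (boolP [exists u : G, exists u', [&& twin u u', adj u u' & ~~ witness u u']]).
  case/existsP=> u /existsP[u' /and3P[tw auu no]]; left; exists u, u'.
  have nbr w : w != u -> w != u' -> adj u' w = adj u w.
    by move=> *; rewrite adj_sym (twin_adj tw) // adj_sym.
  have cl x y : adj u x -> adj u y -> x != u' -> y != u' -> x != y -> adj x y.
    move=> ux uy xu' yu' xy; apply: contraNT no => nxy; apply/existsP; exists x.
    by apply/existsP; exists y; rewrite ux uy xu' yu' xy.
  have su : simplicial u.
    move=> x y; rewrite !inE => ux uy xy.
    have [xu yu] : x != u /\ y != u by split; [move: ux|move: uy]; apply: contraTneq => ->; rewrite adj_irr.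
    case: (eqVneq x u') => [E|xu']; first by rewrite E nbr // -E eq_sym.
    by case: (eqVneq y u') => [E|yu']; [rewrite E adj_sym nbr|apply: cl].
  split=> //.
    split; first by case/andP: tw.
    apply/setP => w; rewrite !inE; case: eqP => //= /eqP wu; case: eqP => //= /eqP wu'.
    by rewrite nbr.
  move=> x y; rewrite !inE => ux uy xy.
  have [xu' yu'] : x != u' /\ y != u' by split; [move: ux|move: uy]; apply: contraTneq => ->; rewrite adj_irr.
  case: (eqVneq x u) => [E|xu]; first by rewrite E -nbr // -E eq_sym.
  case: (eqVneq y u) => [E|yu]; first by rewrite E adj_sym -nbr.
  by apply: cl; rewrite // -nbr.
move=> no; right=> u u' tw auu; case: (boolP (witness u u')) => [/existsP[a /existsP[b]]|nw].
  by case/and5P=> ua ub au' bu' /andP[ab nab]; exists a, b.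
by case/negP: no; apply/existsP; exists u; apply/existsP; exists u'; rewrite tw auu.
Qed.

Lemma module_decomposition (G : sgraph) (X : {set G}) : fork_free G ->
  connected G -> connected (compl G) ->
  is_module X -> 1 < #|X| -> X != [set: G] ->
  (has_adjacent_simplicial_twins G \/ has_adjacent_simplicial_twins (compl G)) \/
  (candled G \/ candled (compl G)).
Proof.
move=> hG cG cG' mX X1 XT.
case: (boolP [exists V : {set G}, [&& is_module V, V != [set: G] & mixed V]]).
  by case/existsP=> V /and3P[mV VT xV]; right; apply: (mixed_module_candled (X := V)).
move=> nomix; have pure (V : {set G}) : is_module V -> V != [set: G] -> ~~ mixed V.
  by move=> mV VT; apply: contra nomix => xV; apply/existsP; exists V; rewrite mV VT.
case: (rich_twinsP G) => [|rich]; first by left; left.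
case: (rich_twinsP (compl G)) => [|rich']; first by left; right.
right; have /card_gt1P[u [u' [uX uX' uu]]] := X1.
have tw := twins_in_module mX (pure X mX XT) uX uX' uu.
case: (boolP (adj u u')) => auu; last exact: (pure_candled hG pure rich rich' tw auu).
(* An adjacent twin pair leads to a stable module, any two members of which are nonadjacent
   twins. *)
have [a [b [ua ub au' bu' [ab nab]]]] := rich u u' tw auu.
have [T [mT nT aT bT _]] := stable_module_of_twins hG pure tw auu ua ub au' bu' ab nab.
exact: (pure_candled hG pure rich rich' (twins_in_module mT nT aT bT ab) nab).
Qed.

Lemma prime_line_graph (G : sgraph) : fork_free G -> prime_graph G ->
  connected G -> connected (compl G) ->
  is_line_graph_of_triangle_free G \/ is_line_graph_of_triangle_free (compl G).
Proof.
move=> hG pG cG cG'.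
have [hasG|[nc nd]] := @conf4P G claw diamond erefl erefl; last first.
  by left; apply: line_graph_of_claw_diamond_free.
have [hasG'|[nc nd]] := @conf4P (compl G) claw diamond erefl erefl; last first.
  by right; apply: line_graph_of_claw_diamond_free.
have [H inH cH] : exists2 H, H \in [:: claw; diamond] & has_conf G H.
  by case: hasG => h; [exists claw|exists diamond]; rewrite // !inE eqxx ?orbT.
have [K inK cK] : exists2 K, K \in [:: claw; diamond] & has_conf (compl G) K.
  by case: hasG' => h; [exists claw|exists diamond]; rewrite // !inE eqxx ?orbT.
by case: (prime_claw_or_coclaw hG pG cG cG' inH inK cH cK).
Qed.

Theorem mainTheorem1 (G : sgraph) (hG : uncluttered G) :
  (~ connected G \/ ~ connected (compl G)) \/
  (has_adjacent_simplicial_twins G \/ has_adjacent_simplicial_twins (compl G)) \/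
  (candled G \/ candled (compl G)) \/
  (is_line_graph_of_triangle_free G \/ is_line_graph_of_triangle_free (compl G)).
Proof.
have fG := uncluttered_fork_free hG.
have [cG|ncG] := connectedP G; last by left; left.
have [cG'|ncG'] := connectedP (compl G); last by left; right.
right; case: (boolP [exists X : {set G}, [&& is_module X, 1 < #|X| & X != [set: G]]]).
  case/existsP=> X /and3P[mX X1 XT].
  by case: (module_decomposition fG cG cG' mX X1 XT); auto.
move=> nomod; right; right; apply: prime_line_graph => // X mX X1; apply/eqP.
by apply: contraNT nomod => XT; apply/existsP; exists X; rewrite mX X1.
Qed.
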